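(* Let $m,N\ge 1$ be integers and let $u_0\in L^2_{\rho^*}(\mathbb{R}^N)$, $u_0\neq 0$. Let $u(x,t)$ be the solution of the Cauchy problem $u_t=-\mathrm{i}\,(-\Delta)^m u$ in $\mathbb{R}^N\times\mathbb{R}_+$, $u|_{t=0}=u_0$. Then there exist a finite integer $l\ge 0$ and a function $\varphi_l(y)$, which is a nontrivial linear combination of the functions $\{\psi_\beta:\ |\beta|=l\}$, such that, as $t\to+\infty$, $$u(x,t)=t^{-\frac{N+l}{2m}}\Big[\varphi_l\Big(\frac{x}{t^{1/2m}}\Big)+O\big(t^{-\frac1{2m}}\big)\Big]$$ uniformly on compact sets in the variable $y=x/t^{1/2m}$.
   Context: Functions are complex-valued. Set $\alpha=\frac{2m}{2m-1}$, $\rho^*(y)=e^{|y|^\alpha}$, and let $L^2_{\rho^*}(\mathbb{R}^N)$ be the space of $v$ with $\int_{\mathbb{R}^N}\rho^*|v|^2\,dy<\infty$. The rescaled kernel $F$ is the function with Fourier symbol $e^{-\mathrm{i}|\omega|^{2m}}$, i.e. $F(y)=(2\pi)^{-N}\int_{\mathbb{R}^N}e^{\mathrm{i}\omega\cdot y-\mathrm{i}|\omega|^{2m}}\,d\omega$ (oscillatory integral/inverse Fourier transform); for $m=1$, $F(y)=(4\pi \mathrm{i})^{-N/2}e^{\mathrm{i}|y|^2/4}$. The solution of the Cauchy problem is $u(x,t)=t^{-\frac N{2m}}\int_{\mathbb{R}^N}F\big((x-z)t^{-\frac1{2m}}\big)u_0(z)\,dz$ for $t>0$. For a multiindex $\beta$,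 $\psi_\beta(y)=\frac{(-1)^{|\beta|}}{\sqrt{\beta!}}D^\beta F(y)$. These are the (''extended'') eigenfunctions, with eigenvalues $\lambda_\beta=-\frac{|\beta|}{2m}$, of the differential expression $\mathbf{B}=-\mathrm{i}(-\Delta)^m+\frac1{2m}\,y\cdot\nabla+\frac N{2m}I$. *)

(* Defs.v *)
From HB Require Import structures.
From mathcomp Require Import all_boot all_order all_algebra.
From mathcomp Require Import all_classical all_reals all_analysis.
From mathcomp Require Import complex.

Set Implicit Arguments.
Unset Strict Implicit.
Unset Printing Implicit Defensive.

Import Order.TTheory GRing.Theory Num.Theory.
Import numFieldNormedType.Exports.

Local Open Scope classical_set_scope.
Local Open Scope ring_scope.

(** R^N is ['rV[R]_N] with the sigma-algebra generated by the coordinates,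
    which is the Borel one.  The library provides only the analogous instance
    for tuples. *)

Definition measure_rV_display : measure_display -> measure_display.
Proof. exact. Qed.

Section measurable_rV.
Context {d} {T : measurableType d} (n : nat).

Let coors : 'I_n -> 'rV[T]_n -> T := fun i v => v ord0 i.

Let rV_set0 : g_sigma_preimage coors set0.
Proof. exact: sigma_algebra0. Qed.

Let rV_setC A : g_sigma_preimage coors A -> g_sigma_preimage coors (~` A).
Proof. exact: sigma_algebraC. Qed.

Let rV_bigcup (F : (set 'rV[T]_n)^nat) :
  (forall i, g_sigma_preimage coors (F i)) ->
  g_sigma_preimage coors (\bigcup_i (F i)).
Proof. exact: sigma_algebra_bigcup. Qed.

HB.instance Definition _ := @isMeasurable.Build (measure_rV_display d)
  'rV[T]_n (g_sigma_preimage coors) rV_set0 rV_setC rV_bigcup.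

End measurable_rV.

Lemma measurable_rV_coord d (T : measurableType d) n (i : 'I_n) :
  measurable_fun [set: 'rV[T]_n] (fun v : 'rV[T]_n => v ord0 i).
Proof.
move=> _ Y mY; rewrite setTI; apply: sub_sigma_algebra => /=.
rewrite -bigcup_seq/=; exists i => /=; first by rewrite mem_index_enum.
by exists Y => //; rewrite setTI.
Qed.

Lemma measurable_fun_rVP d1 d2 (T1 : measurableType d1)
    (T2 : measurableType d2) n (f : T1 -> 'rV[T2]_n) :
  (forall i, measurable_fun [set: T1] (fun x => f x ord0 i)) ->
  measurable_fun [set: T1] f.
Proof.
move=> mf.
suff : g_sigma_preimage (fun (i : 'I_n) x => f x ord0 i) `<=` measurable.
  by rewrite (g_sigma_preimage_comp (fun i (v : 'rV[T2]_n) => v ord0 i)) => h _ A mA;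
    apply: h; exists A.
apply: smallest_sub; first exact: sigma_algebra_measurable.
case: n f mf => [|n] f mf; first by rewrite big_ord0.
rewrite -bigcup_mkord_ord; apply: bigcup_sub => i Ii.
by move=> A [B mB <-]; exact: mf.
Qed.


Section lebesgue_rV_step.
Context {R : realType} (n : nat).

Definition cons_rV (p : measurableTypeR R * 'rV[R]_n) : 'rV[R]_n.+1 :=
  \row_i oapp (p.2 ord0) (p.1 : R) (unlift ord0 i).

Let uncons_rV (v : 'rV[R]_n.+1) : measurableTypeR R * 'rV[R]_n :=
  (v ord0 ord0, \row_i v ord0 (lift ord0 i)).

Lemma cons_rV0 p : cons_rV p ord0 ord0 = p.1.
Proof. by rewrite mxE unlift_none. Qed.

Lemma cons_rVS p (i : 'I_n) : cons_rV p ord0 (lift ord0 i) = p.2 ord0 i.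
Proof. by rewrite mxE liftK. Qed.

Lemma measurable_cons_rV : measurable_fun setT cons_rV.
Proof.
apply: measurable_fun_rVP => i.
have [j ->|->] := unliftP ord0 i.
  under eq_fun do rewrite cons_rVS.
  apply: (@measurableT_comp _ _ _ _ _ _ (fun v : 'rV[R]_n => v ord0 j)) => //.
  exact: measurable_rV_coord.
under eq_fun do rewrite cons_rV0.
exact: measurable_fst.
Qed.

Let uncons_rVK p : uncons_rV (cons_rV p) = p.
Proof.
case: p => x v; congr (_, _); first exact: cons_rV0.
by apply/rowP => i; rewrite mxE cons_rVS.
Qed.

Let measurable_uncons_rV : measurable_fun setT uncons_rV.
Proof.
apply: measurable_fun_pair; first exact: measurable_rV_coord.
apply: measurable_fun_rVP => i; under eq_fun do rewrite mxE.
exact: measurable_rV_coord.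
Qed.

Variable mu : {sigma_finite_measure set 'rV[R]_n -> \bar R}.

Definition lebesgue_rV_step : set 'rV[R]_n.+1 -> \bar R :=
  pushforward (lebesgue_measure \x mu)%E cons_rV.

Let step0 : lebesgue_rV_step set0 = 0%E.
Proof. by rewrite /lebesgue_rV_step /pushforward preimage_set0 measure0. Qed.

Let step_ge0 A : (0 <= lebesgue_rV_step A)%E.
Proof. by rewrite /lebesgue_rV_step /pushforward; exact: measure_ge0. Qed.

Let step_sigma_additive : semi_sigma_additive lebesgue_rV_step.
Proof.
have mf := measurable_cons_rV.
move=> F mF tF mUF; rewrite /lebesgue_rV_step /pushforward preimage_bigcup.
apply: measure_semi_sigma_additive.
- by move=> i; rewrite -[X in measurable X]setTI; exact: mf.
- apply/trivIsetP => /= i j _ _ ij; rewrite -preimage_setI.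
  by move/trivIsetP : tF => /(_ _ _ _ _ ij) ->//; rewrite preimage_set0.
- by rewrite -preimage_bigcup -[X in measurable X]setTI; exact: mf.
Qed.

HB.instance Definition _ := isMeasure.Build _ _ _ lebesgue_rV_step
  step0 step_ge0 step_sigma_additive.

Let step_sigma_finite : sigma_finite setT lebesgue_rV_step.
Proof.
pose m1 : {sigma_finite_measure set (measurableTypeR R) -> \bar R} :=
  lebesgue_measure.
have /sigma_finiteP[F [TF ndF Foo]] := sigma_finiteT m1.
have /sigma_finiteP[G [TG ndG Goo]] := sigma_finiteT mu.
have mFG k : measurable (F k `*` G k).
  by apply: measurableX; [exact: (Foo k).1|exact: (Goo k).1].
exists (fun k => uncons_rV @^-1` (F k `*` G k)).
  rewrite -preimage_bigcup (_ : \bigcup_k (F k `*` G k) = setT) ?preimage_setT//.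
  apply/seteqP; split => // -[x y] _.
  have [n0 _ Fx] : (\bigcup_k F k) x by rewrite -TF.
  have [n1 _ Gy] : (\bigcup_k G k) y by rewrite -TG.
  exists (maxn n0 n1) => //; split.
  - by move: x Fx; exact/subsetPset/ndF/leq_maxl.
  - by move: y Gy; exact/subsetPset/ndG/leq_maxr.
move=> k; have [mFk Fkoo] := Foo k; have [mGk Gkoo] := Goo k; split.
  by rewrite -[X in measurable X]setTI; exact: measurable_uncons_rV.
rewrite /lebesgue_rV_step /pushforward -comp_preimage.
rewrite (_ : uncons_rV \o cons_rV = id); last exact/funext/uncons_rVK.
by rewrite preimage_id product_measure1E// lte_mul_pinfty// ge0_fin_numE.
Qed.

HB.instance Definition _ := @Measure_isSigmaFinite.Build _ _ _
  lebesgue_rV_step step_sigma_finite.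

End lebesgue_rV_step.

(** The library has no Lebesgue measure on R^n: it is built by iterating the
    binary product; [lebesgue_rV_box] gives its value on boxes. *)
Fixpoint lebesgue_rV {R : realType} (n : nat) :
    {sigma_finite_measure set 'rV[R]_n -> \bar R} :=
  if n is n'.+1 then lebesgue_rV_step (@lebesgue_rV R n')
  else \d_(0 : 'rV[R]_0).

Lemma lebesgue_rV_box (R : realType) n (A : 'I_n -> set (measurableTypeR R)) :
  (forall i, measurable (A i)) ->
  lebesgue_rV n [set v : 'rV[R]_n | forall i, A i (v ord0 i)] =
  (\prod_(i < n) lebesgue_measure (A i))%E.
Proof.
elim: n A => [A _|n IH A mA].
  rewrite big_ord0 /= diracE mem_set//= => i; by case: i.
rewrite big_ord_recl /= /lebesgue_rV_step /pushforward.
rewrite -(IH (fun i => A (lift ord0 i)))// -product_measure1E//.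
  congr (_ _); apply/seteqP; split => [p /= h|p /= [h1 h2] i].
    split; first by have := h ord0; rewrite cons_rV0.
    by move=> i; have := h (lift ord0 i); rewrite cons_rVS.
  have [j ->|->] := unliftP ord0 i; first by rewrite cons_rVS.
  by rewrite cons_rV0.
rewrite (_ : [set v | _] = \bigcap_(i in [set: 'I_n])
    ((fun v : 'rV[R]_n => v ord0 i) @^-1` A (lift ord0 i))).
  apply: fin_bigcap_measurable => // i _; rewrite -[X in measurable X]setTI.
  by apply: measurable_rV_coord => //; exact: mA.
by apply/seteqP; split => v h i; [move=> _; exact: h|exact: (h i)].
Qed.

Section complex_valued.
Context {R : realType}.

Definition expi (a : R) : R[i] := (cos a +i* sin a)%C.

Definition complex_measurable N (f : 'rV[R]_N -> R[i]) : Prop :=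
  measurable_fun setT (fun y => complex.Re (f y)) /\
  measurable_fun setT (fun y => complex.Im (f y)).

Definition complex_integral N (f : 'rV[R]_N -> R[i]) : R[i] :=
  (\int[lebesgue_rV N]_y complex.Re (f y) +i*
   \int[lebesgue_rV N]_y complex.Im (f y))%C.

Definition complex_lim (T : Type) (G : set_system T) (f : T -> R[i]) : R[i] :=
  (lim ((fun e => complex.Re (f e)) @ G) +i*
   lim ((fun e => complex.Im (f e)) @ G))%C.

Definition complex_partial N (i : 'I_N) (f : 'rV[R]_N -> R[i])
    (y : 'rV[R]_N) : R[i] :=
  ('D_(delta_mx ord0 i) (fun z => complex.Re (f z)) y +i*
   'D_(delta_mx ord0 i) (fun z => complex.Im (f z)) y)%C.

(** D^beta f, applying d/dy_{N-1} first. *)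
Definition complex_Dmulti N (beta : 'I_N -> nat) (f : 'rV[R]_N -> R[i]) :
    'rV[R]_N -> R[i] :=
  foldr (fun i g => iter (beta i) (complex_partial i) g) f (enum 'I_N).

End complex_valued.

Section schrodinger.
Context {R : realType} {N : nat} (m : nat).

Definition dotv (x y : 'rV[R]_N) : R := \sum_i x ord0 i * y ord0 i.

(** The Euclidean norm: [`|x|] on ['rV[R]_N] is the sup norm. *)
Definition enorm (x : 'rV[R]_N) : R := Num.sqrt (dotv x x).

(** The inverse Fourier transform of e^{-i|w|^{2m}}.  The integrand has modulus
    one, so the integral is an oscillatory one, given by the convergence factor
    e^{-e|w|^{2m}} with e -> 0+ (the value does not depend on the choice of a
    Schwartz convergence factor). *)
Definition kernelF (y : 'rV[R]_N) : R[i] :=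
  (((2 * pi) ^- N)%:C)%C *
  complex_lim 0^'+ (fun e : R => complex_integral (fun w : 'rV[R]_N =>
    ((expR (- (e * enorm w ^+ (2 * m))))%:C)%C *
    expi (dotv w y - enorm w ^+ (2 * m)))).

(** The solution at time t > 0 of u_t = -i(-Delta)^m u with initial datum u0. *)
Definition solution (u0 : 'rV[R]_N -> R[i]) (x : 'rV[R]_N) (t : R) : R[i] :=
  ((t `^ (- (N%:R / (2 * m)%:R)))%:C)%C *
  complex_integral (fun z =>
    kernelF (t `^ (- (1 / (2 * m)%:R)) *: (x - z)) * u0 z).

Definition multi_length (beta : 'I_N -> nat) : nat := \sum_i beta i.

Definition multi_fact (beta : 'I_N -> nat) : nat := \prod_i (beta i)`!.

Definition psi (beta : 'I_N -> nat) (y : 'rV[R]_N) : R[i] :=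
  (((-1) ^+ multi_length beta / Num.sqrt (multi_fact beta)%:R)%:C)%C *
  complex_Dmulti beta kernelF y.

(** The multi-indices of length l have entries at most l, so that they live in
    the finite type [{ffun 'I_N -> 'I_l.+1}]. *)
Definition nontrivial_combination (l : nat) (phi : 'rV[R]_N -> R[i]) : Prop :=
  let mi (beta : {ffun 'I_N -> 'I_l.+1}) : 'I_N -> nat :=
    fun i => nat_of_ord (beta i) in
  exists c : {ffun 'I_N -> 'I_l.+1} -> R[i],
    (exists2 beta, multi_length (mi beta) = l & c beta <> 0) /\
    (forall y, phi y =
       \sum_(beta | multi_length (mi beta) == l) c beta * psi (mi beta) y).

Definition rho_star (y : 'rV[R]_N) : R :=
  expR (enorm y `^ ((2 * m)%:R / (2 * m - 1)%:R)).

Definition L2_rho_star (v : 'rV[R]_N -> R[i]) : Prop :=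
  complex_measurable v /\
  (\int[lebesgue_rV N]_y (rho_star y * Normc.normc (v y) ^+ 2)%:E < +oo)%E.

End schrodinger.

(* Main.v *)
Require Import Defs.
From HB Require Import structures.
From mathcomp Require Import all_boot all_order all_algebra.
From mathcomp Require Import all_classical all_reals all_analysis.
From mathcomp Require Import measurable_realfun complex.
From mathcomp Require Import ring lra.

(** Put s = t^(-1/2m) and y = s x.  Then u(x,t) = s^N int F(y - s z) u0(z) dz, and
    Taylor's formula for F around y gives

      int F(y - s z) u0(z) dz
        = sum_(k <= l) s^k sum_(|beta| = k) c_beta M_beta psi_beta(y) + O(s^(l+1)),

    where M_beta = int z^beta u0(z) dz and c_beta is a positive constant.  If l is
    the least order of a nonvanishing moment, all terms with k < l disappear, the
    term k = l is s^l phi_l(y), and the theorem follows.  Three points need proof.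

    Regularity and growth of F.  The oscillatory integral defining F becomes
    absolutely convergent after the rotation w = zeta eta, zeta = e^(-i pi/4m), of
    the space of frequencies, which turns i|w|^2m into |eta|^2m [kernelF_phase].
    Cauchy's theorem is avoided as follows: the rotated integral, as a function of
    the complex logarithm v of the rotation factor, is differentiable with an
    error O(h^2), and that a real increment of v is a dilation of R^N, which does
    not change the integral: hence the derivative vanishes in every direction
    [rot_integral_quadratic], [rot_integral_const].  On the rotated contour the
    derivatives are obtained under the integral sign [complex_Dmulti_kernel].

    The remainder.  The rotation lets the integrand grow like exp(|eta||y - s z|),
    and Young's inequality for the conjugate exponents 2m and alpha turns this
    growth into exp(C|y - s z|^alpha).  For small s and bounded y this is at most
    a small power of the weight rho^* in z, hence integrable against u0
    [kernel_rem_le], [convolution_expansion].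

    Some moment is nonzero.  As alpha > 1, u0 decays faster than any exponential.
    The functions obtained from polynomials by exponentially dominated limits form
    an algebra, contain sin(a z_i + c), hence the indicators of half-spaces, hence
    those of all measurable sets; if all moments vanished, u0 would integrate to
    zero against all of them [moments_determine].

    The powers (eta.z)^k are expanded over words in the N coordinates rather than
    with multinomial coefficients; the only fact needed on the number of words
    with given letter counts is that it is positive [nontrivial_moment_term]. *)

Set Implicit Arguments.
Unset Strict Implicit.
Unset Printing Implicit Defensive.

Import Order.TTheory GRing.Theory Num.Theory.
Import numFieldNormedType.Exports.

Local Open Scope classical_set_scope.
Local Open Scope ring_scope.

(** * The complex exponential and its Taylor remainder *)

Section complex_exponential.
Context {R : realType}.
Implicit Types (z w : R[i]) (t : R).
Local Notation normc := Normc.normc.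
Local Notation Re := complex.Re.
Local Notation Im := complex.Im.

Lemma cReD z w : Re (z + w) = Re z + Re w.
Proof. by case: z w => [a b] [c d]. Qed.

Lemma cImD z w : Im (z + w) = Im z + Im w.
Proof. by case: z w => [a b] [c d]. Qed.

Lemma cReN z : Re (- z) = - Re z. Proof. by case: z. Qed.

Lemma cImN z : Im (- z) = - Im z. Proof. by case: z. Qed.

Lemma cReM z w : Re (z * w) = Re z * Re w - Im z * Im w.
Proof. by case: z w => [a b] [c d]. Qed.

Lemma cImM z w : Im (z * w) = Re z * Im w + Im z * Re w.
Proof. by case: z w => [a b] [c d]. Qed.

Lemma cReZ t z : Re ((t%:C)%C * z) = t * Re z.
Proof. by case: z => a b /=; rewrite mul0r subr0. Qed.

Lemma cImZ t z : Im ((t%:C)%C * z) = t * Im z.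
Proof. by case: z => a b /=; rewrite mul0r addr0. Qed.

Lemma cRe_sum (I : Type) (r : seq I) (P : pred I) (f : I -> R[i]) :
  Re (\sum_(i <- r | P i) f i) = \sum_(i <- r | P i) Re (f i).
Proof. by apply: (big_morph _ cReD). Qed.

Lemma complexP z w : Re z = Re w -> Im z = Im w -> z = w.
Proof. by case: z w => [a b] [c d] /= -> ->. Qed.

Lemma normc_ge0 z : 0 <= normc z.
Proof. by case: z => a b; exact: sqrtr_ge0. Qed.

Lemma normc_ge_Re_Im z : (`|Re z| <= normc z) * (`|Im z| <= normc z).
Proof.
case: z => a b /=; split; rewrite -sqrtr_sqr ler_wsqrtr//.
  by rewrite lerDl sqr_ge0.
by rewrite lerDr sqr_ge0.
Qed.

Lemma normc_le_Re_Im z : normc z <= `|Re z| + `|Im z|.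
Proof.
case: z => a b /=; rewrite -[leRHS]ger0_norm ?addr_ge0// -sqrtr_sqr.
rewrite ler_wsqrtr// sqrrD !real_normK ?num_real// addrAC lerDl.
by rewrite mulrn_wge0// mulr_ge0.
Qed.

Lemma normc_real t : normc (t%:C)%C = `|t|.
Proof. by rewrite /= expr0n/= addr0 sqrtr_sqr. Qed.

Lemma normcX z n : normc (z ^+ n) = normc z ^+ n.
Proof. by elim: n => [|n IH]; rewrite ?expr0 ?Normc.normc1// !exprS Normc.normcM IH. Qed.

Definition cexp z : R[i] := ((expR (Re z))%:C)%C * expi (Im z).

Lemma cexpD z w : cexp (z + w) = cexp z * cexp w.
Proof.
rewrite /cexp /expi cReD cImD expRD cosD sinD.
by apply: complexP; rewrite !(cReM, cImM)/=; ring.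
Qed.

Lemma cexp_real t : cexp (t%:C)%C = ((expR t)%:C)%C.
Proof. by rewrite /cexp /expi /= cos0 sin0; apply: complexP; rewrite !(cReM, cImM)/=; ring. Qed.

Lemma cexp0 : cexp 0 = 1.
Proof. by rewrite -[0]/((0:R)%:C)%C cexp_real expR0. Qed.

Lemma cexpMn z n : cexp (z *+ n) = cexp z ^+ n.
Proof. by elim: n => [|n IH]; rewrite ?cexp0// mulrS exprS cexpD IH. Qed.

Lemma normc_expi t : normc (expi t) = 1.
Proof. by rewrite /= cos2Dsin2 sqrtr1. Qed.

Lemma normc_cexp z : normc (cexp z) = expR (Re z).
Proof. by rewrite Normc.normcM normc_real normc_expi mulr1 ger0_norm ?expR_ge0. Qed.

Lemma expiE t : expi t = cexp (Complex 0 t).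
Proof. by rewrite /cexp /= expR0 mul1r. Qed.

Lemma normc_cexp_le z : normc (cexp z) <= expR (normc z).
Proof. by rewrite normc_cexp ler_expR (le_trans (ler_norm _))// normc_ge_Re_Im. Qed.

Definition cexp_rem n z := cexp z - \sum_(k < n) z ^+ k / (k`!)%:R.

Lemma cexp_rem1 z : cexp_rem 1 z = cexp z - 1.
Proof. by rewrite /cexp_rem big_ord1 expr0 fact0 divr1. Qed.

Lemma cexp_rem2 z : cexp_rem 2 z = cexp z - 1 - z.
Proof.
by rewrite /cexp_rem big_ord_recl big_ord1 expr0 !fact0 expr1 !divr1 opprD addrA.
Qed.

Lemma ReZ (u z : R[i]) t : Re (u * ((t%:C)%C * z)) = t * Re (u * z).
Proof. by case: u z => a b [c d]; rewrite !(cReM, cImM)/=; ring. Qed.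

(* [u = 1] and [u = -i] give the real and the imaginary part of the remainder
   along the segment from [0] to [z]. *)
Let ray u n z t := Re (u * cexp_rem n ((t%:C)%C * z)).

Lemma rayE u n z t : ray u n z t =
  expR (t * Re z) * (Re u * cos (t * Im z) - Im u * sin (t * Im z))
  - \sum_(k < n) t ^+ k * (Re (u * (z ^+ k / (k`!)%:R))).
Proof.
rewrite /ray /cexp_rem mulrBr cReD cReN; congr (_ - _).
  rewrite /cexp !(cReM, cImM)/= !(mul0r, subr0, addr0); ring.
rewrite mulr_sumr cRe_sum; apply: eq_bigr => k _.
by rewrite exprMn -rmorphXn/= -ReZ; congr Re; rewrite !mulrA.
Qed.

Lemma is_derive_ray u n z t : is_derive t 1 (ray u n.+1 z) (ray (u * z) n z t).
Proof.
rewrite (_ : ray u n.+1 z = fun t => expR (t * Re z) * (Re u * cos (t * Im z) - Im u * sin (t * Im z))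
  - (Re u + \sum_(k < n) (t ^+ k.+1) * (Re (u * (z ^+ k.+1 / (k.+1`!)%:R))))).
  have H : is_derive t 1 (fun t => \sum_(k < n) (t ^+ k.+1) * (Re (u * (z ^+ k.+1 / (k.+1`!)%:R))))
    (\sum_(k < n) (t ^+ k) * (Re (u * z * (z ^+ k / (k`!)%:R)))).
    have -> : (fun t => \sum_(k < n) (t ^+ k.+1) * (Re (u * (z ^+ k.+1 / (k.+1`!)%:R)))) =
      \sum_(k < n) (fun t => (t ^+ k.+1) * (Re (u * (z ^+ k.+1 / (k.+1`!)%:R)))).
      by apply/funext => s; rewrite fct_sumE.
    apply: is_derive_sum => k.
    have -> : u * z * (z ^+ k / k`!%:R) =
        (((k.+1)%:R : R)%:C)%C * (u * (z ^+ k.+1 / (k.+1)`!%:R)).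
      rewrite rmorph_nat factS natrM exprS.
      have n0 : (k.+1)%:R != 0 :> R[i] by rewrite pnatr_eq0.
      rewrite invfM !mulrA; congr (_ * _).
      by rewrite [RHS]mulrC !mulrA mulVf// mul1r.
    rewrite cReZ.
    set c := Re _.
    have -> : (fun s => s ^+ k.+1 * c) = c *: ((@id R) ^+ k.+1).
      by apply/funext => s; rewrite mulrC exprfctE.
    apply: is_derive_eq.
    by rewrite /GRing.scale/=; ring.
  apply: is_derive_eq.
  rewrite rayE !scaler0 !add0r !(cReM u, cImM u) mul1r; congr (_ - _).
  by rewrite /GRing.scale/=; ring.
apply/funext => s; rewrite rayE; congr (_ - _).
by rewrite big_ord_recl/= !expr0 mul1r invr1 mulr1 mulr1.
Qed.

(** The derivative of the remainder of order [n+1] along the ray is [z] times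
    the remainder of order [n]; the mean value theorem only applies to real
    functions, hence the projection by [u]. *)
Lemma Re_cexp_rem_le u n z (B : R) :
  (forall t, 0 < t < 1 -> normc (cexp_rem n ((t%:C)%C * z)) <= B) ->
  `|Re (u * cexp_rem n.+1 z)| <= normc u * normc z * B.
Proof.
move=> hB.
have cont : {within `[0, 1], continuous (ray u n.+1 z)}.
  apply: derivable_within_continuous => t _.
  by have /@ex_derive := is_derive_ray u n z t.
have [t t01] := MVT ltr01 (fun t _ => is_derive_ray u n z t) cont.
have r1 : ray u n.+1 z 1 = Re (u * cexp_rem n.+1 z).
  by rewrite /ray mul1r.
have r0 : ray u n.+1 z 0 = 0.
  rewrite /ray mul0r /cexp_rem cexp0 big_ord_recl/= expr0 divr1 big1 ?addr0 ?subrr ?mulr0//.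
  by move=> i _; rewrite exprS mul0r mul0r.
rewrite r1 r0 !subr0 mulr1 => ->.
apply: le_trans (normc_ge_Re_Im _).1 _.
rewrite !Normc.normcM ler_wpM2l ?mulr_ge0 ?normc_ge0//.
by apply: hB; move: t01; rewrite in_itv.
Qed.

(** Taylor's formula for the exponential, by the mean value theorem along the
    ray through [z]; the constant is far from optimal because the real and
    imaginary parts are estimated separately. *)
Lemma normc_cexp_rem n z :
  normc (cexp_rem n z) <= (2 * normc z) ^+ n * expR (normc z).
Proof.
elim: n z => [|n IH] z.
  by rewrite /cexp_rem big_ord0 subr0 expr0 mul1r normc_cexp_le.
have B t : 0 < t < 1 ->
    normc (cexp_rem n ((t%:C)%C * z)) <= (2 * normc z) ^+ n * expR (normc z).
  move=> /andP[t0 t1]; apply: le_trans (IH _) _.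
  have tz : normc ((t%:C)%C * z) <= normc z.
    by rewrite Normc.normcM normc_real gtr0_norm// ler_piMl ?normc_ge0// ltW.
  rewrite ler_pM ?exprn_ge0 ?mulr_ge0 ?normc_ge0 ?expR_ge0 ?ler_expR//.
  by rewrite lerXn2r ?nnegrE ?mulr_ge0 ?normc_ge0// ler_wpM2l.
have h1 := Re_cexp_rem_le 1 B; have h2 := Re_cexp_rem_le (Complex 0 (-1)) B.
apply: le_trans (normc_le_Re_Im _) _.
have -> : Im (cexp_rem n.+1 z) = Re (Complex 0 (-1) * cexp_rem n.+1 z).
  by rewrite cReM/= mul0r sub0r mulN1r opprK.
move: h1 h2; rewrite Normc.normc1 !mul1r.
have -> : normc (Complex 0 (-1) : R[i]) = 1.
  by rewrite /= expr0n/= add0r sqrrN expr1n sqrtr1.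
rewrite mul1r => h1 h2; apply: le_trans (lerD h1 h2) _.
by rewrite exprS; lra.
Qed.

End complex_exponential.

(** * Complex-valued measurable and integrable functions *)

Section complex_integration.
Context {R : realType}.
Local Notation normc := Normc.normc.
Local Notation Re := complex.Re.
Local Notation Im := complex.Im.

Definition cmeasurable {d} {T : measurableType d} (f : T -> R[i]) :=
  measurable_fun setT (fun y => Re (f y)) /\
  measurable_fun setT (fun y => Im (f y)).

Section measurability.
Context d (T : measurableType d).
Implicit Types (f g : T -> R[i]) (h : T -> R).

Lemma cmeasurable_cst (c : R[i]) : cmeasurable (fun _ : T => c).
Proof. by split; exact: measurable_cst. Qed.

Lemma cmeasurable_real h :
  measurable_fun setT h -> cmeasurable (fun y => ((h y)%:C)%C).
Proof. by split => //; exact: measurable_cst. Qed.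

Lemma cmeasurable_imag h :
  measurable_fun setT h -> cmeasurable (fun y => Complex 0 (h y)).
Proof. by split => //; exact: measurable_cst. Qed.

Lemma cmeasurableD f g :
  cmeasurable f -> cmeasurable g -> cmeasurable (fun y => f y + g y).
Proof.
move=> [f1 f2] [g1 g2]; split.
  by under eq_fun do rewrite cReD; exact: measurable_funD.
by under eq_fun do rewrite cImD; exact: measurable_funD.
Qed.

Lemma cmeasurableM f g :
  cmeasurable f -> cmeasurable g -> cmeasurable (fun y => f y * g y).
Proof.
move=> [f1 f2] [g1 g2]; split.
  under eq_fun do rewrite cReM.
  by apply: measurable_funB; exact: measurable_funM.
under eq_fun do rewrite cImM.
by apply: measurable_funD; exact: measurable_funM.
Qed.

Lemma cmeasurableN f : cmeasurable f -> cmeasurable (fun y => - f y).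
Proof.
move=> mf; under eq_fun do rewrite -mulN1r.
by apply: cmeasurableM => //; exact: cmeasurable_cst.
Qed.

Lemma cmeasurableB f g :
  cmeasurable f -> cmeasurable g -> cmeasurable (fun y => f y - g y).
Proof. by move=> mf mg; apply: cmeasurableD => //; exact: cmeasurableN. Qed.

Lemma cmeasurableX f n : cmeasurable f -> cmeasurable (fun y => f y ^+ n).
Proof.
move=> mf; elim: n => [|n IH].
  by under eq_fun do rewrite expr0; exact: cmeasurable_cst.
by under eq_fun do rewrite exprS; exact: cmeasurableM.
Qed.

Lemma cmeasurable_sum (I : Type) (r : seq I) (P : pred I) (F : I -> T -> R[i]) :
  (forall i, cmeasurable (F i)) ->
  cmeasurable (fun y => \sum_(i <- r | P i) F i y).
Proof.
move=> mF; elim: r => [|i r IH].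
  by under eq_fun do rewrite big_nil; exact: cmeasurable_cst.
under eq_fun do rewrite big_cons.
by case: (P i) => //; exact: cmeasurableD.
Qed.

Lemma cmeasurable_cexp f : cmeasurable f -> cmeasurable (fun y => cexp (f y)).
Proof.
move=> [f1 f2]; have e1 : measurable_fun setT (fun y => expR (Re (f y))).
  exact: measurableT_comp.
apply: cmeasurableM; first exact: cmeasurable_real.
have mc : measurable_fun setT (@cos R).
  by apply: continuous_measurable_fun; exact: continuous_cos.
have ms : measurable_fun setT (@sin R).
  by apply: continuous_measurable_fun; exact: continuous_sin.
by split => /=; [exact: (measurableT_comp mc f2)|exact: (measurableT_comp ms f2)].
Qed.

Lemma measurable_normc f :
  cmeasurable f -> measurable_fun setT (fun y => normc (f y)).
Proof.
move=> [f1 f2]; have -> : (fun y => normc (f y)) =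
    (fun y => Num.sqrt (Re (f y) ^+ 2 + Im (f y) ^+ 2)).
  by apply/funext => y; case: (f y).
have ms : measurable_fun setT (@Num.sqrt R).
  by apply: continuous_measurable_fun; exact: sqrt_continuous.
apply: (measurableT_comp ms).
by apply: measurable_funD; exact: measurable_funX.
Qed.

End measurability.

Section integral.
Context {N : nat}.
Local Notation mu := (lebesgue_rV N).
Implicit Types (f g : 'rV[R]_N -> R[i]) (h : 'rV[R]_N -> R).

Definition rintegrable h := mu.-integrable setT (EFin \o h).

Definition cintegrable f :=
  rintegrable (fun y => Re (f y)) /\ rintegrable (fun y => Im (f y)).

Lemma rintegrable_le h k : measurable_fun setT h -> rintegrable k ->
  (forall y, `|h y| <= k y) -> rintegrable h.
Proof.
move=> mh ik hk; apply: (le_integrable measurableT _ _ ik).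
  exact/measurable_EFinP.
by move=> y _ /=; rewrite lee_fin (le_trans (hk y))// ler_norm.
Qed.

Lemma cintegrable_le f h : cmeasurable f -> rintegrable h ->
  (forall y, normc (f y) <= h y) -> cintegrable f.
Proof.
move=> [f1 f2] ih fh; split.
  apply: rintegrable_le ih _ => // y.
  by apply: le_trans (fh y); exact: (normc_ge_Re_Im _).1.
apply: rintegrable_le ih _ => // y.
by apply: le_trans (fh y); exact: (normc_ge_Re_Im _).2.
Qed.

Lemma rintegrableD h k :
  rintegrable h -> rintegrable k -> rintegrable (fun y => h y + k y).
Proof. by move=> ih ik; have := integrableD measurableT ih ik. Qed.

Lemma rintegrableZ c h : rintegrable h -> rintegrable (fun y => c * h y).
Proof. by move=> ih; have := integrableZl measurableT c ih. Qed.

Lemma cintegrableD f g :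
  cintegrable f -> cintegrable g -> cintegrable (fun y => f y + g y).
Proof.
move=> [f1 f2] [g1 g2]; split; rewrite /rintegrable/comp.
  by under eq_fun do rewrite cReD; exact: rintegrableD.
by under eq_fun do rewrite cImD; exact: rintegrableD.
Qed.

Lemma cintegrableZ c f : cintegrable f -> cintegrable (fun y => c * f y).
Proof.
move=> [f1 f2]; split; rewrite /rintegrable/comp.
  under eq_fun do rewrite cReM -mulNr.
  by apply: rintegrableD; exact: rintegrableZ.
under eq_fun do rewrite cImM.
by apply: rintegrableD; exact: rintegrableZ.
Qed.

Lemma cintegralD f g : cintegrable f -> cintegrable g ->
  complex_integral (fun y => f y + g y) =
  complex_integral f + complex_integral g.
Proof.
move=> [f1 f2] [g1 g2]; apply: complexP => /=.
  by rewrite -RintegralD//; apply: eq_Rintegral => y _; rewrite cReD.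
by rewrite -RintegralD//; apply: eq_Rintegral => y _; rewrite cImD.
Qed.

Lemma cintegralZ c f : cintegrable f ->
  complex_integral (fun y => c * f y) = c * complex_integral f.
Proof.
move=> [f1 f2]; apply: complexP; rewrite ?cReM ?cImM /= -!RintegralZl//.
  rewrite -RintegralB//; try exact: rintegrableZ.
  by apply: eq_Rintegral => y _; rewrite cReM.
rewrite -RintegralD//; try exact: rintegrableZ.
by apply: eq_Rintegral => y _; rewrite cImM.
Qed.

Lemma cintegralB f g : cintegrable f -> cintegrable g ->
  complex_integral (fun y => f y - g y) =
  complex_integral f - complex_integral g.
Proof.
move=> cf cg; rewrite -[- complex_integral g]mulN1r -cintegralZ//.
rewrite -cintegralD//; last exact: cintegrableZ.
by congr complex_integral; apply/funext => y; rewrite mulN1r.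
Qed.

Lemma cintegral0 : complex_integral (fun _ : 'rV[R]_N => 0 : R[i]) = 0.
Proof. by apply: complexP => /=; rewrite Rintegral_cst// mul0r. Qed.

Lemma cintegrable0 : cintegrable (fun=> 0).
Proof. by split; exact: integrable0. Qed.

Lemma cintegrable_sum (I : Type) (r : seq I) (P : pred I)
    (F : I -> 'rV[R]_N -> R[i]) : (forall i, cintegrable (F i)) ->
  cintegrable (fun y => \sum_(i <- r | P i) F i y).
Proof.
move=> iF; elim: r => [|i r IH].
  by under eq_fun do rewrite big_nil; exact: cintegrable0.
under eq_fun do rewrite big_cons.
by case: (P i) => //; exact: cintegrableD.
Qed.

Lemma cintegral_sum (I : Type) (r : seq I) (P : pred I)
    (F : I -> 'rV[R]_N -> R[i]) : (forall i, cintegrable (F i)) ->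
  complex_integral (fun y => \sum_(i <- r | P i) F i y) =
  \sum_(i <- r | P i) complex_integral (F i).
Proof.
move=> iF; elim: r => [|i r IH].
  by under eq_fun do rewrite big_nil; rewrite big_nil cintegral0.
under eq_fun do rewrite big_cons.
rewrite big_cons; case: (P i) => //.
by rewrite cintegralD ?IH//; exact: cintegrable_sum.
Qed.

(** The factor 2, harmless for all the estimates below, avoids rotating the
    integral onto the real axis. *)
Lemma normc_cintegral_le f h : cmeasurable f -> rintegrable h ->
  (forall y, normc (f y) <= h y) ->
  normc (complex_integral f) <= 2 * \int[mu]_y h y.
Proof.
move=> mf ih fh; have [f1 f2] := cintegrable_le mf ih fh.
apply: le_trans (normc_le_Re_Im _) _; rewrite mulr_natl mulr2n /=.
by apply: lerD; (apply: le_trans (le_normr_Rintegral _ _) _ => //);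
  (apply: le_Rintegral => //; first exact: (integrable_norm));
  move=> y _; apply: le_trans (fh y); apply normc_ge_Re_Im.
Qed.

End integral.

(** A parameter integral is measurable in the parameter: apply Tonelli's
    theorem to the positive and negative parts. *)
Lemma cmeasurable_cintegral N d (T : measurableType d)
    (f : T * 'rV[R]_N -> R[i]) : cmeasurable f ->
  cmeasurable (fun y => complex_integral (fun w => f (y, w))).
Proof.
have H (h : T * 'rV[R]_N -> R) : measurable_fun setT h ->
    measurable_fun setT (fun y => \int[lebesgue_rV N]_w h (y, w)).
  move=> mh; rewrite /Rintegral.
  apply: (measurableT_comp (f := fine)); first exact: fine_measurable.
  have mE : measurable_fun setT (EFin \o h) by exact/measurable_EFinP.
  under eq_fun do rewrite integralE.
  apply: emeasurable_funB.
    apply: (eq_measurable_fun (fubini_F (lebesgue_rV N) (EFin \o h)^\+%E)).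
      by move=> y _; apply: eq_integral => w _; rewrite !funeposE.
    by apply: measurable_fun_fubini_tonelli_F => //; exact: measurable_funepos.
  apply: (eq_measurable_fun (fubini_F (lebesgue_rV N) (EFin \o h)^\-%E)).
    by move=> y _; apply: eq_integral => w _; rewrite !funenegE.
  by apply: measurable_fun_fubini_tonelli_F => //; exact: measurable_funeneg.
by move=> [f1 f2]; split; [exact: (H _ f1)|exact: (H _ f2)].
Qed.

End complex_integration.

(** * Dilations of Lebesgue measure and integrability of exponentials *)

Section lebesgue_line.
Context {R : realType}.
Local Notation mu := (@lebesgue_measure R).

(** The integrand is even and, on the half-line, a multiple of the exponential
    density. *)
Lemma integrable_expR_abs (c : R) : 0 < c ->
  (\int[mu]_x (expR (- (c * `|x|)))%:E < +oo)%E.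
Proof.
move=> c0.
have cf : continuous (fun x : R => expR (- (c * `|x|))).
  move=> x; apply: continuous_comp; last exact: continuous_expR.
  apply: (@continuousN _ R^o); apply: continuousM; first exact: cst_continuous.
  exact: (@norm_continuous _ R^o).
rewrite ge0_symfun_integralT//; last by move=> x /=; rewrite normrN.
rewrite lte_mul_pinfty//.
have mpos : measurable [set x : R | (0 <= x)%R] by rewrite -set_itvcy.
have mpdf : measurable_fun setT (EFin \o exponential_pdf c).
  by apply/measurable_EFinP; exact: measurable_exponential_pdf.
have pdf0 x : (0 <= (exponential_pdf c x)%:E)%E.
  by rewrite lee_fin exponential_pdf_ge0 // ltW.
apply: (@le_lt_trans _ _ (c^-1%:E * \int[mu]_x (exponential_pdf c x)%:E)%E); last first.
  by rewrite integral_exponential_pdf// mule1 ltry.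
rewrite -ge0_integralZl//; last by rewrite lee_fin invr_ge0 ltW.
apply: (@le_trans _ _ (\int[mu]_(x in [set x | (0 <= x)%R]) (c^-1%:E * (exponential_pdf c x)%:E))%E).
  rewrite le_eqVlt; apply/orP; left; apply/eqP/eq_integral => x.
  rewrite inE/= => x0; rewrite exponential_pdfE// -EFinM mulrA mulVf ?gt_eqF// mul1r.
  by rewrite ger0_norm// mulNr.
apply: ge0_subset_integral => //.
  by apply: measurable_funeM; exact: mpdf.
by move=> x _; apply: mule_ge0 => //; rewrite lee_fin invr_ge0 ltW.
Qed.

Lemma measurable_scale (r : R) : measurable_fun setT
  (fun x : measurableTypeR R => (r * x : measurableTypeR R)).
Proof. exact: mulrl_measurable. Qed.

Definition scaled_lebesgue (r : R) (r0 : 0 < r) :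
    {measure set (measurableTypeR R) -> \bar R} :=
  mscale (NngNum (ltW r0))
    (measure_function_pushforward__canonical__measure_function_Measure
      lebesgue_measure (measurable_scale r)).

(** Both sides are measures agreeing on intervals. *)
Lemma lebesgue_measure_scale (r : R) (A : set (measurableTypeR R)) : 0 < r ->
  measurable A ->
  lebesgue_measure A = (r%:E * lebesgue_measure ((fun x : R => (r * x)%R) @^-1` A))%E.
Proof.
move=> r0 mA.
pose nu := scaled_lebesgue r0.
have := @lebesgue_measure_unique R nu; apply => // X /ocitvP[->|[[a b] /= ab ->]].
  by rewrite !measure0.
change (lebesgue_measure `]a, b]%classic =
  (r%:E * lebesgue_measure ((fun x : R => (r * x)%R) @^-1` `]a, b]%classic))%E).
rewrite (_ : _ @^-1` _ = `](r^-1 * a), (r^-1 * b)]%classic); last first.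
  apply/seteqP; split => x /=; rewrite !in_itv/= => /andP[h1 h2]; apply/andP; split.
  - by rewrite mulrC ltr_pdivrMr// mulrC.
  - by rewrite mulrC ler_pdivlMr// mulrC.
  - by move: h1; rewrite mulrC ltr_pdivrMr// mulrC.
  - by move: h2; rewrite mulrC ler_pdivlMr// mulrC.
rewrite !lebesgue_measure_itv/= !lte_fin ab ltr_pM2l ?invr_gt0// ab.
by rewrite -!EFinB -EFinM -mulrBr mulrA divff ?gt_eqF// mul1r.
Qed.

Lemma ge0_integral_scale (r : R) (f : R -> \bar R) : 0 < r ->
  measurable_fun setT f -> (forall x, 0 <= f x)%E ->
  (\int[mu]_x f x = r%:E * \int[mu]_x f (r * x)%R)%E.
Proof.
move=> r0 mf f0.
pose nu := scaled_lebesgue r0.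
rewrite (eq_measure_integral nu); last first.
  by move=> A mA _; exact: (lebesgue_measure_scale r0 mA).
rewrite /nu ge0_integral_mscale//= ge0_integral_pushforward//.
exact: measurable_scale.
Qed.

End lebesgue_line.

Section lebesgue_space.
Context {R : realType}.

Lemma ge0_integral_rVS n (f : 'rV[R]_n.+1 -> \bar R) :
  measurable_fun setT f -> (forall x, 0 <= f x)%E ->
  (\int[lebesgue_rV n.+1]_y f y =
   \int[lebesgue_measure]_x \int[lebesgue_rV n]_v f (cons_rV (x, v)))%E.
Proof.
move=> mf f0.
have mc := @measurable_cons_rV R n.
rewrite /= /lebesgue_rV_step ge0_integral_pushforward// preimage_setT.
by rewrite fubini_tonelli1// => [|p]; [exact: measurableT_comp|exact: f0].
Qed.

Lemma measurable_scale_rV n (r : R) :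
  measurable_fun setT (fun y : 'rV[R]_n => r *: y).
Proof.
apply: measurable_fun_rVP => i; under eq_fun do rewrite mxE.
by apply: measurable_funM => //; exact: measurable_rV_coord.
Qed.

Lemma scale_cons_rV n (r : R) p : r *: @cons_rV R n p = cons_rV (r * p.1, r *: p.2).
Proof.
apply/rowP => i; rewrite !mxE; case: (unlift _ _) => [j|] //=.
by rewrite mxE.
Qed.

(** The Lebesgue measure of R^n is homogeneous of degree n. *)
Lemma ge0_integral_rV_scale n (r : R) (f : 'rV[R]_n -> \bar R) : 0 < r ->
  measurable_fun setT f -> (forall x, 0 <= f x)%E ->
  (\int[lebesgue_rV n]_y f y =
   (r ^+ n)%:E * \int[lebesgue_rV n]_y f (r *: y)%R)%E.
Proof.
move=> r0; elim: n f => [|n IH] f mf f0.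
  rewrite expr0 mul1e; apply: eq_integral => y _.
  by congr f; apply/rowP => -[].
have mfr : measurable_fun setT (fun y : 'rV[R]_n.+1 => f (r *: y)).
  by apply: measurableT_comp => //; exact: measurable_scale_rV.
have mfc : measurable_fun setT (f \o @cons_rV R n).
  by apply: measurableT_comp => //; exact: measurable_cons_rV.
rewrite !ge0_integral_rVS//.
pose g (x : R) := (\int[lebesgue_rV n]_v f (cons_rV (x, v)))%E.
have mg : measurable_fun setT g.
  by apply: (@measurable_fun_fubini_tonelli_F _ _ _ _ _ (lebesgue_rV n)
    (f \o @cons_rV R n)) => // p; exact: f0.
have g0 x : (0 <= g x)%E by exact: integral_ge0.
rewrite -/(g _) (ge0_integral_scale r0 mg g0).
have -> : (\int[lebesgue_measure]_x g (r * x)%R =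
  (r ^+ n)%:E * \int[lebesgue_measure]_x
    \int[lebesgue_rV n]_v f (r *: cons_rV (x, v))%R)%E.
  rewrite -ge0_integralZl//; last 3 first.
  - apply: (@measurable_fun_fubini_tonelli_F _ _ _ _ _ (lebesgue_rV n)
      ((fun y => f (r *: y)) \o @cons_rV R n)) => [|p]; last exact: f0.
    by apply: measurableT_comp => //; exact: measurable_cons_rV.
  - by move=> x _; exact: integral_ge0.
  - by rewrite lee_fin exprn_ge0// ltW.
  apply: eq_integral => x _; rewrite /g.
  rewrite (IH (fun v => f (cons_rV (r * x, v)))) //; last first.
    exact: (measurableT_comp mfc (pair1_measurable _)).
  by congr (_ * _)%E; apply: eq_integral => v _; rewrite scale_cons_rV.
by rewrite muleA -EFinM exprS.
Qed.

Definition norm1 n (y : 'rV[R]_n) := \sum_i `|y ord0 i|.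

Lemma norm1_ge0 n (y : 'rV[R]_n) : 0 <= norm1 y.
Proof. by apply: sumr_ge0. Qed.

Lemma measurable_norm1 n : measurable_fun setT (@norm1 n).
Proof.
apply: measurable_sum => i.
by apply: measurableT_comp => //; exact: measurable_rV_coord.
Qed.

Lemma norm1_cons n p : norm1 (@cons_rV R n p) = `|p.1| + norm1 p.2.
Proof.
rewrite /norm1 big_ord_recl cons_rV0; congr (_ + _).
by apply: eq_bigr => i _; rewrite cons_rVS.
Qed.

(** With the l^1 norm the exponential is a product of functions of one
    variable, so that Tonelli's theorem applies coordinate by coordinate. *)
Lemma integral_expR_norm1 n (c : R) : 0 < c ->
  (\int[lebesgue_rV n]_y (expR (- (c * norm1 y)))%:E < +oo)%E.
Proof.
move=> c0; elim: n => [|n IH].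
  under eq_integral do rewrite /norm1 big_ord0 mulr0 oppr0 expR0.
  by rewrite integral_cst// mul1e /= diracE ltry.
have mE k : measurable_fun setT (fun y : 'rV[R]_k => (expR (- (c * norm1 y)))%:E).
  apply/measurable_EFinP; apply: measurableT_comp => //.
  apply: measurable_funN; apply: measurable_funM => //; exact: measurable_norm1.
rewrite ge0_integral_rVS//.
set I := (\int[lebesgue_rV n]_y _)%E in IH.
have I0 : (0 <= I)%E by apply: integral_ge0 => y _; rewrite lee_fin expR_ge0.
have Ifin : I \is a fin_num by rewrite ge0_fin_numE.
have m1 : measurable_fun setT (fun x : measurableTypeR R => (expR (- (c * `|x|)))%:E).
  apply/measurable_EFinP; apply: measurableT_comp => //.
  by apply: measurable_funN; apply: measurable_funM.
apply: (@le_lt_trans _ _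
    (\int[lebesgue_measure]_x (I * (expR (- (c * `|x|)))%:E))%E).
  rewrite le_eqVlt; apply/orP; left; apply/eqP/eq_integral => x _.
  rewrite muleC /I -ge0_integralZl//; last exact: mE.
  apply: eq_integral => v _.
  by rewrite norm1_cons/= mulrDr opprD expRD EFinM.
rewrite -(fineK Ifin) ge0_integralZl_EFin ?fine_ge0//.
by rewrite lte_mul_pinfty ?lee_fin ?fine_ge0// integrable_expR_abs.
Qed.

End lebesgue_space.

(** * The Euclidean norm and the weights exp(b|w| - c|w|^2m) *)

Section euclidean_norm.
Context {R : realType} {N : nat}.
Implicit Types (x y w : 'rV[R]_N).

Lemma dotv_ge0 x : 0 <= dotv x x.
Proof. by apply: sumr_ge0 => i _; rewrite -expr2 sqr_ge0. Qed.

Lemma enorm_ge0 x : 0 <= enorm x. Proof. exact: sqrtr_ge0. Qed.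

Lemma coord_le_enorm x i : `|x ord0 i| <= enorm x.
Proof.
rewrite -sqrtr_sqr ler_wsqrtr// /dotv (bigD1 i)//= expr2 lerDl.
by apply: sumr_ge0 => j _; rewrite -expr2 sqr_ge0.
Qed.

Lemma norm1_le_enorm x : norm1 x <= N%:R * enorm x.
Proof.
apply: le_trans (ler_sum _ (fun i _ => coord_le_enorm x i)) _.
by rewrite sumr_const card_ord mulr_natl.
Qed.

(** A cheap substitute for the Cauchy-Schwarz inequality, bounding each
    coordinate of [x] by its norm; constants depending on [N] are harmless. *)
Lemma dotv_le x y : `|dotv x y| <= enorm x * norm1 y.
Proof.
apply: le_trans (ler_norm_sum _ _ _) _; rewrite mulr_sumr.
by apply: ler_sum => i _; rewrite normrM ler_wpM2r// coord_le_enorm.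
Qed.

Lemma dotvC x y : dotv x y = dotv y x.
Proof. by apply: eq_bigr => i _; rewrite mulrC. Qed.

Lemma dotvZl r x y : dotv (r *: x) y = r * dotv x y.
Proof. by rewrite /dotv mulr_sumr; apply: eq_bigr => i _; rewrite mxE mulrA. Qed.

Lemma dotvZr r x y : dotv x (r *: y) = r * dotv x y.
Proof. by rewrite dotvC dotvZl dotvC. Qed.

Lemma dotvDr x y z : dotv x (y + z) = dotv x y + dotv x z.
Proof. by rewrite /dotv -big_split/=; apply: eq_bigr => i _; rewrite mxE mulrDr. Qed.

Lemma dotvNr x y : dotv x (- y) = - dotv x y.
Proof. by rewrite -scaleN1r dotvZr mulN1r. Qed.

Lemma dotv_delta x i : dotv x (delta_mx ord0 i) = x ord0 i.
Proof.
rewrite /dotv (bigD1 i)//= mxE !eqxx mulr1 big1 ?addr0// => j ji.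
by rewrite mxE (negbTE ji) andbF mulr0.
Qed.

Lemma enormZ r x : 0 <= r -> enorm (r *: x) = r * enorm x.
Proof.
by move=> r0; rewrite /enorm dotvZl dotvZr mulrA -expr2 sqrtrM ?sqr_ge0// sqrtr_sqr ger0_norm.
Qed.

Lemma measurable_dotv d (T : measurableType d) (f g : T -> 'rV[R]_N) :
  measurable_fun setT f -> measurable_fun setT g ->
  measurable_fun setT (fun t => dotv (f t) (g t)).
Proof.
move=> mf mg; apply: measurable_sum => i; apply: measurable_funM.
  exact: (measurableT_comp (measurable_rV_coord i) mf).
exact: (measurableT_comp (measurable_rV_coord i) mg).
Qed.

Lemma measurable_enorm : measurable_fun setT (@enorm R N).
Proof.
have ms : measurable_fun setT (@Num.sqrt R).
  by apply: continuous_measurable_fun; exact: sqrt_continuous.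
by apply: (measurableT_comp ms); exact: measurable_dotv.
Qed.

Lemma rintegrable_expR_enorm c : 0 < c ->
  rintegrable (fun y : 'rV[R]_N => expR (- (c * enorm y))).
Proof.
move=> c0; have cN : 0 < c / (N.+1)%:R by rewrite divr_gt0.
have i1 : rintegrable (fun y : 'rV[R]_N => expR (- (c / (N.+1)%:R * norm1 y))).
  apply/integrableP; split.
    apply/measurable_EFinP; apply: measurableT_comp => //.
    by apply: measurable_funN; apply: measurable_funM => //; exact: measurable_norm1.
  under eq_integral do rewrite /= ger0_norm ?expR_ge0//.
  exact: integral_expR_norm1.
apply: rintegrable_le i1 _ => [|y].
  apply: measurableT_comp => //; apply: measurable_funN.
  by apply: measurable_funM => //; exact: measurable_enorm.
rewrite ger0_norm ?expR_ge0// ler_expR lerN2 -mulrA ler_wpM2l ?(ltW c0)//.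
rewrite mulrC ler_pdivrMr// mulrC; apply: le_trans (norm1_le_enorm _) _.
by rewrite ler_wpM2r ?enorm_ge0// ler_nat.
Qed.

End euclidean_norm.

Section weights.
Context {R : realType} {N : nat} (m : nat) (hm : (1 <= m)%N).

Lemma le_expR (x : R) : x <= expR x.
Proof. by apply: le_trans (expR_ge1Dx x); rewrite lerDr. Qed.

Lemma expR_ge1 (x : R) : 0 <= x -> 1 <= expR x.
Proof. by move=> x0; rewrite -expR0 ler_expR. Qed.

Lemma expr2m_ge (r : R) : 0 <= r -> r ^+ 2 - 1 <= r ^+ (2 * m).
Proof.
move=> r0; have [r1|r1] := leP 1 r.
  apply: (@le_trans _ _ (r ^+ 2)); first by rewrite gerBl.
  by rewrite ler_weXn2l// leq_pmulr.
apply: (@le_trans _ _ 0); last exact: exprn_ge0.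
by rewrite subr_le0 exprn_ile1// ltW.
Qed.

(** Since r^2m >= r^2 - 1 it suffices to complete a square. *)
Lemma weight_exponent_le (b c r : R) : 0 < c -> 0 <= r ->
  b * r - c * r ^+ (2 * m) <= c + (b + 1) ^+ 2 / (4 * c) - r.
Proof.
move=> c0 r0; have := expr2m_ge r0; rewrite -(ler_pM2l c0) => h.
have e : (b + 1) ^+ 2 / (4 * c) - ((b + 1) * r - c * r ^+ 2) =
    (b + 1 - 2 * c * r) ^+ 2 / (4 * c) by field; rewrite gt_eqF.
have : 0 <= (b + 1 - 2 * c * r) ^+ 2 / (4 * c).
  by rewrite divr_ge0 ?sqr_ge0// mulr_ge0// ltW.
by rewrite -e; lra.
Qed.

Definition weight (b c : R) (w : 'rV[R]_N) :=
  expR (b * enorm w - c * enorm w ^+ (2 * m)).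

Lemma measurable_weight b c : measurable_fun setT (weight b c).
Proof.
apply: measurableT_comp => //; apply: measurable_funB.
  by apply: measurable_funM => //; exact: measurable_enorm.
apply: measurable_funM => //; apply: measurable_funX; exact: measurable_enorm.
Qed.

Lemma rintegrable_weight b c : 0 < c -> rintegrable (weight b c).
Proof.
move=> c0; pose K := expR (c + (b + 1) ^+ 2 / (4 * c)).
apply: (@rintegrable_le _ _ _ (fun w => K * expR (- (1 * enorm w)))).
- exact: measurable_weight.
- by apply: rintegrableZ; exact: rintegrable_expR_enorm.
move=> w; rewrite ger0_norm ?expR_ge0// /K -expRD ler_expR mul1r.
by apply: weight_exponent_le => //; exact: enorm_ge0.
Qed.

Lemma weight_ge0 b c w : 0 <= weight b c w. Proof. exact: expR_ge0. Qed.

End weights.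

(** * Rotation of the contour of integration *)

Section scaling_integrals.
Context {R : realType} {N : nat}.
Local Notation mu := (@lebesgue_rV R N).

(** The statement for nonnegative functions, applied to the positive and
    negative parts. *)
Lemma integral_rV_scale (r : R) (h : 'rV[R]_N -> R) : 0 < r ->
  rintegrable h -> \int[mu]_w h w = r ^+ N * \int[mu]_w h (r *: w).
Proof.
move=> r0 ih; have [mh _] := integrableP _ _ _ ih.
have fp : (\int[mu]_w (EFin \o h)^\+ w)%E \is a fin_num.
  exact: integrable_pos_fin_num.
have fn : (\int[mu]_w (EFin \o h)^\- w)%E \is a fin_num.
  exact: integrable_neg_fin_num.
have rN : (r ^+ N != 0) by rewrite expf_eq0 (gt_eqF r0) andbF.
have E (g : 'rV[R]_N -> \bar R) : measurable_fun setT g -> (forall x, 0 <= g x)%E ->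
    (\int[mu]_w g (r *: w) = (r ^+ N)^-1%:E * \int[mu]_w g w)%E.
  move=> mg g0; rewrite (ge0_integral_rV_scale r0 mg g0) muleA -EFinM.
  by rewrite mulVf// mul1e.
have ep : (\int[mu]_w (EFin \o h)^\+ (r *: w)%R)%E =
   ((r ^+ N)^-1%:E * \int[mu]_w (EFin \o h)^\+ w)%E.
  by apply: E => [|x]; [exact: measurable_funepos|exact: funepos_ge0].
have en : (\int[mu]_w (EFin \o h)^\- (r *: w)%R)%E =
   ((r ^+ N)^-1%:E * \int[mu]_w (EFin \o h)^\- w)%E.
  by apply: E => [|x]; [exact: measurable_funeneg|exact: funeneg_ge0].
rewrite /Rintegral [in RHS]integralE.
rewrite (_ : (\int[mu]_w (fun w => (h (r *: w))%:E)^\+ w)%E =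
   (\int[mu]_w (EFin \o h)^\+ (r *: w)%R)%E); last first.
  by apply: eq_integral => w _; rewrite !funeposE.
rewrite (_ : (\int[mu]_w (fun w => (h (r *: w))%:E)^\- w)%E =
   (\int[mu]_w (EFin \o h)^\- (r *: w)%R)%E); last first.
  by apply: eq_integral => w _; rewrite !funenegE.
rewrite ep en [in LHS]integralE -(fineK fp) -(fineK fn) -!EFinM -!EFinB /=.
by rewrite -mulrBr mulrA divff// mul1r.
Qed.

Lemma cintegral_scale (r : R) (f : 'rV[R]_N -> R[i]) : 0 < r -> cintegrable f ->
  complex_integral f =
  ((r ^+ N)%:C)%C * complex_integral (fun w => f (r *: w)).
Proof.
move=> r0 [f1 f2]; apply: complexP; rewrite ?cReZ ?cImZ /=.
  exact: (integral_rV_scale r0 f1).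
exact: (integral_rV_scale r0 f2).
Qed.

End scaling_integrals.

Section rotation.
Context {R : realType} {N : nat} (m : nat) (hm : (1 <= m)%N).
Local Notation normc := Normc.normc.
Local Notation Re := complex.Re.
Local Notation Im := complex.Im.
Local Notation "x %:C" := (real_complex R x).
Variables (y : 'rV[R]_N) (a : R[i]) (kappa : R).
Hypothesis kappa0 : 0 < kappa.
Hypothesis a2 : normc a <= 2.

Implicit Types (v h : R[i]) (w : 'rV[R]_N).

Let P (v : R[i]) (w : 'rV[R]_N) : R[i] := cexp v * Complex 0 (dotv w y).
Let Q (v : R[i]) (w : 'rV[R]_N) : R[i] :=
  a * cexp (v *+ (2 * m)) * (enorm w ^+ (2 * m))%:C.

(** The integrand of the Fourier integral after the change of variables
    [w |-> e^v w], including its Jacobian. *)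
Definition rot_integrand (v : R[i]) (w : 'rV[R]_N) : R[i] :=
  cexp (v *+ N + P v w - Q v w).

Definition rot_integral (v : R[i]) : R[i] := complex_integral (rot_integrand v).

(** The purely imaginary [v] for which the rotated integrand still decays. *)
Definition admissible (v : R[i]) :=
  Re v = 0 /\ kappa <= Re (a * cexp (v *+ (2 * m))).

Let p (w : 'rV[R]_N) : R := `|dotv w y|.
Let q (w : 'rV[R]_N) : R := enorm w ^+ (2 * m).
Let s w : R := 1 + p w + q w.

Let p0 w : 0 <= p w. Proof. exact: normr_ge0. Qed.
Let q0 w : 0 <= q w. Proof. by rewrite exprn_ge0 ?enorm_ge0. Qed.
Let s0 w : 1 <= s w. Proof. by rewrite /s -addrA lerDl addr_ge0. Qed.

Lemma cmeasurable_rot v : cmeasurable (rot_integrand v).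
Proof.
have mw : measurable_fun setT (fun w : 'rV[R]_N => w) by exact: measurable_id.
have md : measurable_fun setT (fun w : 'rV[R]_N => dotv w y).
  by apply: measurable_dotv.
apply: cmeasurable_cexp; apply: cmeasurableB.
  apply: cmeasurableD; first exact: cmeasurable_cst.
  by apply: cmeasurableM; [exact: cmeasurable_cst|split].
apply: cmeasurableM; first exact: cmeasurable_cst.
by apply: cmeasurable_real; apply: measurable_funX; exact: measurable_enorm.
Qed.

Let cexp1 v : Re v = 0 -> normc (cexp v) = 1.
Proof. by move=> v0; rewrite normc_cexp v0 expR0. Qed.

Let ReMn v n : Re v = 0 -> Re (v *+ n) = 0.
Proof. by move=> v0; elim: n => [//|n IH]; rewrite mulrS cReD v0 IH addr0. Qed.

Let normP v w : Re v = 0 -> normc (P v w) = p w.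
Proof.
move=> v0; rewrite /P Normc.normcM cexp1// mul1r /= expr0n/= add0r.
by rewrite sqrtr_sqr.
Qed.

Let normQ v w : Re v = 0 -> normc (Q v w) <= 2 * q w.
Proof.
move=> v0; rewrite /Q 2!Normc.normcM cexp1 ?ReMn// mulr1 normc_real.
by rewrite ger0_norm ?q0// ler_wpM2r ?q0.
Qed.

Let rot_le v w : admissible v ->
  normc (rot_integrand v w) <= expR (p w - kappa * q w).
Proof.
move=> [v0 av]; rewrite /rot_integrand normc_cexp ler_expR !cReD cReN ReMn// add0r.
apply: lerB; first by apply: le_trans (ler_norm _) _; rewrite -(normP w v0) normc_ge_Re_Im.
by rewrite /Q [X in Re X]mulrC cReZ mulrC ler_wpM2l ?q0.
Qed.

(* [E] bounds exp(2m|h|) for |h| <= 1; [K] and [K2] are the resulting first and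
   second order bounds for the increment [B] of the exponent. *)
Let E : R := expR (2 * m)%:R.
Let K : R := (N + 8 * m)%:R * E.
Let K2 : R := (32 * m ^ 2)%:R * E.

Let B v h w := h *+ N + (cexp h - 1) * P v w - (cexp (h *+ (2 * m)) - 1) * Q v w.

Let rotD v h w : rot_integrand (v + h) w = rot_integrand v w * cexp (B v h w).
Proof.
rewrite /rot_integrand -cexpD; congr cexp; rewrite /B /P /Q cexpD !mulrnDl cexpD.
ring.
Qed.

Let normcMn' h n : normc (h *+ n) = n%:R * normc h.
Proof. by rewrite mulr_natl; exact: normcMn. Qed.

Let m1 : 1 <= m%:R :> R. Proof. by rewrite ler1n. Qed.

Let E1 : 1 <= E. Proof. by rewrite /E expR_ge1. Qed.

Let expm1_le h n : (n <= 2 * m)%N -> normc h <= 1 ->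
  normc (cexp (h *+ n) - 1) <= 2 * n%:R * E * normc h.
Proof.
move=> n2 h1; have := normc_cexp_rem 1 (h *+ n).
rewrite cexp_rem1 expr1 => /le_trans; apply.
rewrite normcMn'.
have : expR (n%:R * normc h) <= E.
  rewrite ler_expR; apply: (@le_trans _ _ n%:R); first by rewrite ler_piMr.
  by rewrite ler_nat.
have /ler_wpM2l h' : 0 <= 2 * (n%:R * normc h) by rewrite !mulr_ge0 ?normc_ge0.
by move=> /h'; rewrite !mulrA [_ * E * _]mulrAC.
Qed.

Let expm2_le h n : (n <= 2 * m)%N -> normc h <= 1 ->
  normc (cexp (h *+ n) - 1 - h *+ n) <= 4 * n%:R ^+ 2 * E * normc h ^+ 2.
Proof.
move=> n2 h1; have := normc_cexp_rem 2 (h *+ n).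
rewrite cexp_rem2.
move=> /le_trans; apply.
rewrite normcMn'.
have : expR (n%:R * normc h) <= E.
  rewrite ler_expR; apply: (@le_trans _ _ n%:R); first by rewrite ler_piMr.
  by rewrite ler_nat.
have /ler_wpM2l h' : 0 <= (2 * (n%:R * normc h)) ^+ 2 by rewrite sqr_ge0.
move=> /h' /le_trans; apply; rewrite le_eqVlt; apply/orP; left; apply/eqP; ring.
Qed.

Let B_le v h w : Re v = 0 -> normc h <= 1 -> normc (B v h w) <= normc h * K * s w.
Proof.
move=> v0 h1; rewrite /B.
have e1 := @expm1_le h 1 _ h1; have e2 := @expm1_le h (2 * m) (leqnn _) h1.
rewrite mulr1n mulr1 in e1.
have {}e1 : normc (cexp h - 1) <= 2 * E * normc h by apply: e1; rewrite muln_gt0.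
apply: le_trans (le_normcD _ _) _; rewrite normcN.
apply: (@le_trans _ _ (N%:R * normc h + 2 * E * normc h * p w + 2 * (2 * m)%:R * E * normc h * (2 * q w))).
  apply: lerD.
    apply: le_trans (le_normcD _ _) _; apply: lerD.
      by rewrite normcMn'.
    by rewrite Normc.normcM (normP w v0) ler_wpM2r.
  by rewrite Normc.normcM ler_pM ?normc_ge0// normQ.
have h0 := normc_ge0 h; rewrite /K /s.
rewrite -subr_ge0 natrD !natrM.
have -> : normc h * ((N%:R + 8%:R * m%:R) * E) * (1 + p w + q w) -
  (N%:R * normc h + 2 * E * normc h * p w + 2 * (2 * m%:R) * E * normc h * (2 * q w)) =
  normc h * ( N%:R * (E - 1) + 8 * m%:R * E + N%:R * E * (p w + q w) +
     (8 * m%:R - 2) * E * p w ) by ring.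
have EE : 0 <= E by apply: le_trans E1.
have m0 : 0 <= m%:R :> R by [].
by rewrite mulr_ge0// !addr_ge0 ?mulr_ge0 ?subr_ge0 ?addr_ge0//; move: m1; lra.
Qed.

Let B2_le v h w : Re v = 0 -> normc h <= 1 ->
  normc (B v h w - h * (N%:R + P v w - (2 * m)%:R * Q v w)) <= normc h ^+ 2 * K2 * s w.
Proof.
move=> v0 h1; rewrite /B.
have e1 := @expm2_le h 1 _ h1; have e2 := @expm2_le h (2 * m) (leqnn _) h1.
rewrite mulr1n expr1n mulr1 in e1.
have {}e1 : normc (cexp h - 1 - h) <= 4 * E * normc h ^+ 2 by apply: e1; rewrite muln_gt0.
have -> : h *+ N + (cexp h - 1) * P v w - (cexp (h *+ (2 * m)) - 1) * Q v w -
   h * (N%:R + P v w - (2 * m)%:R * Q v w) =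
   (cexp h - 1 - h) * P v w - (cexp (h *+ (2 * m)) - 1 - h *+ (2 * m)) * Q v w.
  rewrite -[h *+ N]mulr_natr -[h *+ (2 * m)]mulr_natr.
  move: (cexp _) (cexp _) => c1 c2; ring.
apply: le_trans (le_normcD _ _) _; rewrite normcN.
apply: (@le_trans _ _ (4 * E * normc h ^+ 2 * p w + 4 * (2 * m)%:R ^+ 2 * E * normc h ^+ 2 * (2 * q w))).
  apply: lerD; first by rewrite Normc.normcM (normP w v0) ler_wpM2r.
  by rewrite Normc.normcM ler_pM ?normc_ge0// normQ.
have h0 := normc_ge0 h; rewrite /K2 /s -subr_ge0.
have -> : (32 * m ^ 2)%:R = 32 * m%:R ^+ 2 :> R by rewrite natrM natrX.
have -> : (2 * m)%:R = 2 * m%:R :> R by rewrite natrM.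
have -> : normc h ^+ 2 * (32 * m%:R ^+ 2 * E) * (1 + p w + q w) -
  (4 * E * normc h ^+ 2 * p w +
   4 * (2 * m%:R) ^+ 2 * E * normc h ^+ 2 * (2 * q w)) =
  normc h ^+ 2 * E * (32 * m%:R ^+ 2 + (32 * m%:R ^+ 2 - 4) * p w) .
  ring.
have EE : 0 <= E by apply: le_trans E1.
have : 1 <= m%:R ^+ 2 :> R by rewrite exprn_ege1.
move=> m2; rewrite mulr_ge0 ?mulr_ge0 ?sqr_ge0// addr_ge0 ?mulr_ge0//; move: m2; lra.
Qed.

(* The decay rate [kappa] is spent as follows: half of it absorbs the powers of
   [s] and the increment of the exponent, in three parts of size [tau]. *)
Let tau := kappa / 6.
Let tau0 : 0 < tau. Proof. by rewrite divr_gt0. Qed.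

Let s_le w : s w <= tau^-1 * expR (tau * s w).
Proof. by rewrite mulrC ler_pdivlMr// mulrC le_expR. Qed.

Let D w := expR (p w - kappa * q w) * expR (3 * tau * s w).

Let D_le_weight w : D w <= expR (kappa / 2) * weight m ((1 + kappa / 2) * norm1 y) (kappa / 2) w.
Proof.
rewrite /D /weight -!expRD ler_expR /tau /s -/(q w).
have : p w <= enorm w * norm1 y by exact: dotv_le.
have /ler_wpM2l h : 0 <= 1 + kappa / 2 by rewrite addr_ge0// divr_ge0// ltW.
by move=> /h; lra.
Qed.

Let W w := expR (kappa / 2) * weight m ((1 + kappa / 2) * norm1 y) (kappa / 2) w.
Let iW c : rintegrable (fun w => c * W w).
Proof. by do 2 apply: rintegrableZ; apply: rintegrable_weight => //; rewrite divr_gt0. Qed.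

Let K0 : 0 < K.
Proof.
by apply: mulr_gt0; [rewrite ltr0n addn_gt0 muln_gt0 hm orbT|exact: expR_gt0].
Qed.

Let delta := Num.min 1 (tau / K).
Let delta0 : 0 < delta. Proof. by rewrite lt_min ltr01 divr_gt0. Qed.

Let near0_le h : normc h <= delta -> normc h <= 1 /\ normc h * K <= tau.
Proof. by rewrite le_min => /andP[h1 h2]; split=> //; rewrite -ler_pdivlMr. Qed.

Let rotD_integrable v h : admissible v -> normc h <= delta -> cintegrable (rot_integrand (v + h)).
Proof.
move=> av /near0_le[h1 hK]; apply: cintegrable_le (iW 1) _; first exact: cmeasurable_rot.
move=> w; rewrite mul1r; apply: le_trans (D_le_weight w).
rewrite rotD Normc.normcM; apply: ler_pM (normc_ge0 _) (normc_ge0 _) (rot_le w av) _.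
apply: le_trans (normc_cexp_le _) _; rewrite ler_expR.
apply: le_trans (B_le w av.1 h1) _; rewrite ler_wpM2r ?(le_trans _ (s0 w))//.
by move: tau0; lra.
Qed.

(* The logarithmic derivative of the integrand in [v]. *)
Let A1 v w := N%:R + P v w - (2 * m)%:R * Q v w.

Let A1_le v w : Re v = 0 -> normc (A1 v w) <= (N + 4 * m)%:R * s w.
Proof.
move=> v0; rewrite /A1; apply: le_trans (le_normcD _ _) _; rewrite normcN.
apply: (@le_trans _ _ (N%:R + p w + (2 * m)%:R * (2 * q w))).
  apply: lerD.
    apply: le_trans (le_normcD _ _) _; rewrite (normP w v0).
    by rewrite -(rmorph_nat (real_complex R)) normc_real normr_nat.
  rewrite Normc.normcM -(rmorph_nat (real_complex R)) normc_real normr_nat.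
  by rewrite ler_wpM2l// normQ.
rewrite /s natrD !natrM; have := p0 w; have := q0 w; move: m1.
move: (p w) (q w) => p' q' mm qq pp.
have n0 : 0 <= N%:R :> R by [].
rewrite -subr_ge0.
have -> : (N%:R + 4%:R * m%:R) * (1 + p' + q') - (N%:R + p' + 2 * m%:R * (2 * q')) =
  4 * m%:R + N%:R * p' + (4 * m%:R - 1) * p' + N%:R * q' by ring.
by rewrite !addr_ge0 ?mulr_ge0//; lra.
Qed.

Let cmeasurable_A1 v : cmeasurable (A1 v).
Proof.
have md : measurable_fun setT (fun w : 'rV[R]_N => dotv w y).
  by apply: measurable_dotv.
apply: cmeasurableB.
  apply: cmeasurableD; first exact: cmeasurable_cst.
  by apply: cmeasurableM; [exact: cmeasurable_cst|split].
apply: cmeasurableM; first exact: cmeasurable_cst.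
apply: cmeasurableM; first exact: cmeasurable_cst.
by apply: cmeasurable_real; apply: measurable_funX; exact: measurable_enorm.
Qed.

Let rot1_integrable v : admissible v -> cintegrable (fun w => rot_integrand v w * A1 v w).
Proof.
move=> av; apply: cintegrable_le (iW ((N + 4 * m)%:R / tau)) _.
  by apply: cmeasurableM; [exact: cmeasurable_rot|exact: cmeasurable_A1].
move=> w; rewrite Normc.normcM.
apply: (@le_trans _ _ ((N + 4 * m)%:R / tau * D w)); last first.
  by rewrite ler_wpM2l ?D_le_weight// divr_ge0// ltW.
rewrite /D mulrCA; apply: ler_pM (normc_ge0 _) (normc_ge0 _) (rot_le w av) _.
apply: le_trans (A1_le w av.1) _; rewrite -[leRHS]mulrA ler_wpM2l//.
apply: le_trans (s_le w) _; rewrite ler_wpM2l ?invr_ge0 ?(ltW tau0)// ler_expR.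
by rewrite ler_wpM2r ?(le_trans _ (s0 w))//; move: tau0; lra.
Qed.

Let C0 := 4 * K ^+ 2 * tau^-1 ^+ 2 + K2 * tau^-1.

Let C00 : 0 <= C0.
Proof.
have t0 : 0 <= tau^-1 by rewrite invr_ge0 ltW.
have K20 : 0 <= K2 by apply: mulr_ge0 => //; exact: expR_ge0.
apply: addr_ge0; last exact: mulr_ge0.
by apply: mulr_ge0; [apply: mulr_ge0 => //|]; exact: sqr_ge0.
Qed.

Let rot_rem_le v h w : admissible v -> normc h <= delta ->
  normc (rot_integrand (v + h) w - rot_integrand v w - h * (rot_integrand v w * A1 v w)) <=
  normc h ^+ 2 * C0 * W w.
Proof.
move=> av /near0_le[h1 hK].
have -> : rot_integrand (v + h) w - rot_integrand v w - h * (rot_integrand v w * A1 v w) =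
  rot_integrand v w * ((cexp (B v h w) - 1 - B v h w) + (B v h w - h * A1 v w)).
  rewrite rotD; ring.
have s1 := s0 w; have sp : 0 <= s w by apply: le_trans s1.
have h0 := normc_ge0 h.
apply: (@le_trans _ _ (normc h ^+ 2 * C0 * D w)); last first.
  apply: ler_wpM2l (D_le_weight w); apply: mulr_ge0 C00; exact: sqr_ge0.
rewrite /D mulrCA Normc.normcM.
apply: ler_pM (normc_ge0 _) (normc_ge0 _) (rot_le w av) _.
apply: le_trans (le_normcD _ _) _.
have b1 := B_le w av.1 h1; have b2 := B2_le w av.1 h1; have b0 := normc_ge0 (B v h w).
have r2 : normc (cexp (B v h w) - 1 - B v h w) <= 4 * normc (B v h w) ^+ 2 * expR (normc (B v h w)).
  have := normc_cexp_rem 2 (B v h w).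
  rewrite cexp_rem2.
  by rewrite exprMn => /le_trans; apply; rewrite -natrX.
have t1 : expR (normc (B v h w)) <= expR (tau * s w).
  by rewrite ler_expR (le_trans b1)// ler_wpM2r.
have e0 : 1 <= expR (tau * s w) by rewrite expR_ge1// mulr_ge0// ltW.
have sl := s_le w.
set e := expR (tau * s w) in t1 e0 sl.
have -> : expR (3 * tau * s w) = e ^+ 3.
  by rewrite /e -expRM_natl; congr expR; ring.
rewrite /C0 [leRHS](_ : _ = 4 * (normc h * K) ^+ 2 * e * (tau^-1 * e) ^+ 2 +
  normc h ^+ 2 * K2 * (tau^-1 * e ^+ 3)); last by ring.
have e00 : 0 <= e by apply: le_trans e0.
apply: lerD.
  apply: le_trans r2 _.
  have b12 : normc (B v h w) ^+ 2 <= (normc h * K * s w) ^+ 2.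
    by rewrite lerXn2r ?nnegrE// mulr_ge0// mulr_ge0// ltW.
  apply: (@le_trans _ _ (4 * (normc h * K * s w) ^+ 2 * e)).
    apply: ler_pM => //; first by apply: mulr_ge0 => //; exact: sqr_ge0.
    by rewrite ler_wpM2l.
  have sl2 : s w ^+ 2 <= (tau^-1 * e) ^+ 2.
    by rewrite lerXn2r ?nnegrE// mulr_ge0 ?invr_ge0// ltW.
  have c0 : 0 <= 4 * (normc h * K) ^+ 2 * e.
    by apply: mulr_ge0 => //; apply: mulr_ge0 => //; exact: sqr_ge0.
  apply: le_trans (ler_wpM2l c0 sl2).
  by rewrite exprMn le_eqVlt; apply/orP; left; apply/eqP; ring.
apply: le_trans b2 _; apply: ler_wpM2l.
  by apply: mulr_ge0; [exact: sqr_ge0|apply: mulr_ge0 => //; exact: expR_ge0].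
apply: le_trans sl _; apply: ler_wpM2l; first by rewrite invr_ge0 ltW.
by rewrite -[leLHS]expr1; exact: ler_weXn2l.
Qed.

Let rot_integrable v : admissible v -> cintegrable (rot_integrand v).
Proof.
move=> av; rewrite -[v]addr0; apply: rotD_integrable => //.
by rewrite Normc.normc0 ltW.
Qed.

(* A real increment of [v] is a dilation of the variable of integration. *)
Let rot_shift v (t : R) : admissible v -> `|t| <= delta ->
  rot_integral (v + t%:C) = rot_integral v.
Proof.
move=> av td; have et : 0 < expR t := expR_gt0 t.
have iv := @rotD_integrable v t%:C av; rewrite normc_real in iv.
rewrite /rot_integral [RHS](cintegral_scale et (rot_integrable av)).
rewrite -expRM_natl -cexp_real.
have Erot : rot_integrand (v + t%:C) =
    fun w => cexp (t%:C *+ N) * rot_integrand v (expR t *: w).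
  apply/funext => w; rewrite /rot_integrand -cexpD; congr cexp; rewrite /P /Q.
  have -> : dotv (expR t *: w) y = expR t * dotv w y by rewrite dotvZl.
  rewrite (enormZ _ (ltW et)) exprMn -expRM_natl !mulrnDl !cexpD.
  have -> : t%:C *+ (2 * m) = ((2 * m)%:R * t)%:C.
    by rewrite mulr_natl rmorphMn.
  rewrite !cexp_real.
  have -> : Complex 0 (expR t * dotv w y) = (expR t)%:C * Complex 0 (dotv w y).
    by apply: complexP; rewrite ?cReZ ?cImZ/= ?mulr0.
  rewrite rmorphM/=; ring.
have -> : (N%:R * t)%:C = t%:C *+ N by rewrite mulr_natl rmorphMn.
have cn : cexp (t%:C *+ N) != 0.
  apply/eqP => c0; have := expR_gt0 (Re (t%:C *+ N)).
  by rewrite -normc_cexp c0 Normc.normc0 ltxx.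
rewrite Erot cintegralZ//.
have -> : (fun w => rot_integrand v (expR t *: w)) =
   (fun w => (cexp (t%:C *+ N))^-1 * rot_integrand (v + t%:C) w).
  by apply/funext => w; rewrite Erot mulKf.
exact: cintegrableZ (iv td).
Qed.

(** Moving the contour by [h] changes the integral by O(h^2): the first order
    term is the same for all directions of the complex plane, and it vanishes in
    the real direction, which is a real dilation. *)
Lemma rot_integral_quadratic : exists C d : R, 0 < d /\
  forall v h, admissible v -> normc h <= d ->
  normc (rot_integral (v + h) - rot_integral v) <= C * normc h ^+ 2.
Proof.
pose C := 2 * (C0 * \int[lebesgue_rV N]_w W w).
exists C, delta; split => // v h av hd.
pose Phi1 := complex_integral (fun w => rot_integrand v w * A1 v w).
have H h' : normc h' <= delta ->
    normc (rot_integral (v + h') - rot_integral v - h' * Phi1) <= C * normc h' ^+ 2.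
  move=> h'd; rewrite /rot_integral /Phi1 -cintegralZ; last exact: rot1_integrable.
  rewrite -cintegralB; [|exact: rotD_integrable|exact: rot_integrable].
  rewrite -cintegralB; last 2 first.
  - under eq_fun do rewrite -mulN1r.
    apply: cintegrableD; [exact: rotD_integrable|apply: cintegrableZ; exact: rot_integrable].
  - exact/cintegrableZ/rot1_integrable.
  apply: le_trans (normc_cintegral_le (h := fun w => (normc h' ^+ 2 * C0) * W w) _ _ _) _.
  - apply: cmeasurableB; first by apply: cmeasurableB; exact: cmeasurable_rot.
    apply: cmeasurableM; first exact: cmeasurable_cst.
    by apply: cmeasurableM; [exact: cmeasurable_rot|exact: cmeasurable_A1].
  - exact: iW.
  - by move=> w; exact: rot_rem_le.
  rewrite RintegralZl//; last by have := iW 1; under eq_fun do rewrite mul1r.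
  by rewrite /C le_eqVlt; apply/orP; left; apply/eqP; ring.
suff Phi10 : Phi1 = 0 by have := H h hd; rewrite Phi10 mulr0 subr0.
have Hr (t : R) : 0 < t -> t <= delta -> normc Phi1 <= C * t.
  move=> t0 td; have ta : `|t| <= delta by rewrite gtr0_norm.
  have := H t%:C; rewrite normc_real => /(_ ta); rewrite (rot_shift av ta) subrr sub0r.
  rewrite normcN Normc.normcM normc_real gtr0_norm//.
  by rewrite expr2 mulrA [C * t * t]mulrC ler_pM2l.
apply: Normc.eq0_normc; apply/eqP; rewrite eq_le normc_ge0 andbT.
apply/ler_addgt0Pr => e e0; rewrite add0r.
pose t := Num.min delta (e / (`|C| + 1)).
have C1 : 0 < `|C| + 1 by rewrite ltr_wpDl.
have t0 : 0 < t by rewrite lt_min delta0 divr_gt0.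
apply: le_trans (Hr t t0 _) _; first by rewrite ge_min lexx.
have : t <= e / (`|C| + 1) by rewrite ge_min lexx orbT.
rewrite ler_pdivlMr// => ht; apply: le_trans ht.
by rewrite mulrC ler_pM2l// (le_trans (ler_norm C))// lerDl.
Qed.

(** Cutting the segment into n pieces, the total variation is O(n (1/n)^2). *)
Lemma rot_integral_const (theta : R) : 0 <= theta ->
  (forall x, 0 <= x <= theta -> admissible (Complex 0 (- x))) ->
  rot_integral (Complex 0 (- theta)) = rot_integral 0.
Proof.
move=> th0 adm; have [C [d [d0 H]]] := rot_integral_quadratic.
pose z n k : R[i] := Complex 0 (- (theta * k%:R / n%:R)).
have step n k : (k < n)%N -> theta / n%:R <= d ->
    normc (rot_integral (z n k.+1) - rot_integral (z n k)) <= C * (theta / n%:R) ^+ 2.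
  move=> kn tn; have n0 : 0 < n%:R :> R by rewrite ltr0n (leq_trans _ kn).
  have -> : z n k.+1 = z n k + Complex 0 (- (theta / n%:R)).
    by apply: complexP; rewrite ?cReD ?cImD/= ?addr0// -natr1; field; rewrite gt_eqF.
  have nh : normc (Complex 0 (- (theta / n%:R))) = theta / n%:R.
    by rewrite /= expr0n add0r sqrtr_sqr normrN ger0_norm// divr_ge0.
  rewrite -{2}nh; apply: H; last by rewrite nh.
  apply: adm; rewrite divr_ge0 ?mulr_ge0//= ler_pdivrMr// ler_wpM2l// ler_nat.
  exact: ltnW.
have tele n k : (k <= n)%N -> theta / n%:R <= d ->
    normc (rot_integral (z n k) - rot_integral (z n 0%N)) <= k%:R * (C * (theta / n%:R) ^+ 2).
  move=> + tn; elim: k => [_|k IH kn]; first by rewrite subrr Normc.normc0 mul0r.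
  rewrite -natr1 mulrDl mul1r [leRHS]addrC.
  have -> : rot_integral (z n k.+1) - rot_integral (z n 0%N) =
    (rot_integral (z n k.+1) - rot_integral (z n k)) + (rot_integral (z n k) - rot_integral (z n 0%N)).
    by rewrite addrA subrK.
  apply: le_trans (le_normcD _ _) _; apply: lerD; first exact: step.
  by apply: IH; exact: ltnW.
apply/eqP; rewrite -subr_eq0; apply/eqP; apply: Normc.eq0_normc.
apply/eqP; rewrite eq_le normc_ge0 andbT.
apply/ler_addgt0Pr => e e0; rewrite add0r.
pose n := (Num.truncn (theta / d + `|C| * theta ^+ 2 / e)).+1.
have nn : theta / d + `|C| * theta ^+ 2 / e < n%:R by exact: Num.Theory.truncnS_gt.
have n0 : 0 < n%:R :> R by rewrite ltr0n.
have x0 : 0 <= theta / d by rewrite divr_ge0// ltW.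
have x1 : 0 <= `|C| * theta ^+ 2 / e by rewrite divr_ge0 ?mulr_ge0 ?sqr_ge0// ltW.
have tn : theta / n%:R <= d.
  rewrite ler_pdivrMr// mulrC -ler_pdivrMr//; apply/ltW/(le_lt_trans _ nn).
  by rewrite lerDl.
have := tele n n (leqnn _) tn.
have -> : z n n = Complex 0 (- theta) by rewrite /z mulfK// gt_eqF.
have -> : z n 0%N = 0 by rewrite /z mulr0 mul0r oppr0.
move=> /le_trans; apply.
have -> : n%:R * (C * (theta / n%:R) ^+ 2) = C * theta ^+ 2 / n%:R.
  by field; rewrite gt_eqF.
rewrite ler_pdivrMr// [leRHS]mulrC -ler_pdivrMr//.
apply: (@le_trans _ _ (`|C| * theta ^+ 2 / e)).
  by rewrite ler_pM2r ?invr_gt0// ler_wpM2r ?sqr_ge0// ler_norm.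
by apply/ltW/(le_lt_trans _ nn); rewrite lerDr.
Qed.

End rotation.

(** * The kernel as an absolutely convergent integral *)

Section limits.
Context {R : realType}.
Local Notation normc := Normc.normc.
Local Notation Re := complex.Re.
Local Notation Im := complex.Im.

Lemma lim_at_right0 (g : R -> R) (L C : R) :
  (forall e, 0 < e < 2^-1 -> `|g e - L| <= C * e) -> lim (g e @[e --> 0^'+]) = L.
Proof.
move=> h; apply: cvg_lim => //; apply/cvgrPdist_le => e e0.
near=> t; rewrite distrC; apply: le_trans (h t _) _.
  by apply/andP; split; near: t; [exact: nbhs_right_gt|exact: nbhs_right_lt].
have t0 : 0 < t by near: t; exact: nbhs_right_gt.
apply: (@le_trans _ _ ((`|C| + 1) * t)).
  by rewrite ler_pM2r// (le_trans (ler_norm C))// lerDl.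
rewrite mulrC -ler_pdivlMr ?ltr_wpDl//.
by near: t; apply: nbhs_right_le; rewrite divr_gt0// ltr_wpDl.
Unshelve. all: by end_near. Qed.

Lemma complex_lim_at_right0 (g : R -> R[i]) (L : R[i]) (C : R) :
  (forall e, 0 < e < 2^-1 -> normc (g e - L) <= C * e) ->
  complex_lim 0^'+ g = L.
Proof.
move=> h; apply: complexP => /=.
  apply: (@lim_at_right0 _ _ C) => e /h; apply: le_trans.
  by rewrite -cReN -cReD; exact: (normc_ge_Re_Im _).1.
apply: (@lim_at_right0 _ _ C) => e /h; apply: le_trans.
by rewrite -cImN -cImD; exact: (normc_ge_Re_Im _).2.
Qed.

(** A quadratic estimate of the increment identifies a directional derivative;
    this is how the integrals below are differentiated. *)
Lemma derive_quadratic (V : normedModType R) (f : V -> R) (y v : V) (L C : R) :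
  (forall h, `|h| <= 1 -> `|f (h *: v + y) - f y - h * L| <= C * h ^+ 2) ->
  'D_v f y = L.
Proof.
move=> H; apply: cvg_lim => //; apply/cvgrPdist_le => e e0.
near=> h.
have h0 : h != 0 by near: h; exact: nbhs_dnbhs_neq.
have hn : 0 < `|h| by rewrite normr_gt0.
have h1 : `|h| < 1 by near: h; apply: dnbhs0_lt.
have -> : L - h^-1 *: ((f \o shift y) (h *: v) - f y) =
   - (h^-1 * (f (h *: v + y) - f y - h * L)).
  by rewrite /= /GRing.scale/=; field.
rewrite normrN normrM normfV mulrC ler_pdivrMr//.
apply: le_trans (H h (ltW h1)) _.
have hC : `|h| < e / (`|C| + 1).
  by near: h; apply: dnbhs0_lt; rewrite divr_gt0// ltr_wpDl.
move: hC; rewrite ltr_pdivlMr ?ltr_wpDl// => hC.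
rewrite -real_normK ?num_real// expr2 mulrA ler_pM2r//.
apply/ltW/(le_lt_trans _ hC); rewrite mulrC ler_pM2l//.
by rewrite (le_trans (ler_norm C))// lerDl.
Unshelve. all: by end_near. Qed.

Lemma complex_partial_quadratic N (i : 'I_N) (f : 'rV[R]_N -> R[i]) y L C :
  (forall h : R, `|h| <= 1 ->
    normc (f (h *: delta_mx ord0 i + y) - f y - (h%:C)%C * L) <= C * h ^+ 2) ->
  complex_partial i f y = L.
Proof.
move=> H; apply: complexP => /=.
  apply: (@derive_quadratic _ _ _ _ _ C) => h /H; apply: le_trans.
  by rewrite -cReZ -!cReN -!cReD; exact: (normc_ge_Re_Im _).1.
apply: (@derive_quadratic _ _ _ _ _ C) => h /H; apply: le_trans.
by rewrite -cImZ -!cImN -!cImD; exact: (normc_ge_Re_Im _).2.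
Qed.

End limits.

Section kernel.
Context {R : realType} {N : nat} (m : nat) (hm : (1 <= m)%N).
Local Notation normc := Normc.normc.
Local Notation Re := complex.Re.
Local Notation Im := complex.Im.
Local Notation "x %:C" := (real_complex R x).
Implicit Types (y w z : 'rV[R]_N) (e : R).

(** The angle that turns the symbol i|w|^2m into |w|^2m. *)
Definition rot_angle : R := pi / (4 * m)%:R.

Definition zeta : R[i] := cexp (Complex 0 (- rot_angle)).

Definition izeta : R[i] := zeta * Complex 0 1.

Lemma normc_zeta : normc zeta = 1.
Proof. by rewrite normc_cexp expR0. Qed.

Lemma normc_izeta : normc izeta = 1.
Proof.
rewrite Normc.normcM normc_zeta mul1r /= expr0n/= add0r expr1n.
by rewrite sqrtr1.
Qed.

(** The integrand e^(i w.y - i|w|^2m) on the rotated contour. *)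
Definition phase y w : R[i] :=
  cexp (izeta * (dotv w y)%:C - (enorm w ^+ (2 * m))%:C).

Definition phase_integral (P : 'rV[R]_N -> R[i]) y : R[i] :=
  complex_integral (fun w => P w * phase y w).

Lemma normc_phase y w : normc (phase y w) <= weight m (norm1 y) 1 w.
Proof.
rewrite normc_cexp ler_expR cReD cReN mul1r; apply: lerB => //.
apply: le_trans (ler_norm _) _; apply: le_trans (normc_ge_Re_Im _).1 _.
by rewrite Normc.normcM normc_izeta mul1r normc_real mulrC dotv_le.
Qed.

Lemma cmeasurable_dotv y : cmeasurable (fun w => (dotv w y)%:C).
Proof. by apply: cmeasurable_real; exact: measurable_dotv. Qed.

Lemma cmeasurable_phase y : cmeasurable (phase y).
Proof.
apply: cmeasurable_cexp; apply: cmeasurableB.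
  apply: cmeasurableM; first exact: cmeasurable_cst.
  exact: cmeasurable_dotv.
by apply: cmeasurable_real; apply: measurable_funX; exact: measurable_enorm.
Qed.

Let Complex0 (r : R) : Complex 0 r = r%:C * Complex 0 1.
Proof. by apply: complexP; rewrite ?cReZ ?cImZ/= ?mulr0 ?mulr1. Qed.

Let rot_angle_half : Complex 0 (- rot_angle) *+ (2 * m) = Complex 0 (- (pi / 2)).
Proof.
rewrite Complex0 -mulrnAl -rmorphMn/= [in RHS]Complex0; congr (_%:C * _).
rewrite /rot_angle -mulr_natl !natrM.
by field; rewrite pnatr_eq0 -lt0n.
Qed.

Let cexp_mpihalf : cexp (Complex 0 (- (pi / 2))) = Complex 0 (-1) :> R[i].
Proof. by rewrite -expiE /expi cosN sinN cos_pihalf sin_pihalf. Qed.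

Lemma rot_integrand0 y e w : rot_integrand m y (Complex e 1) 0 w =
  (expR (- (e * enorm w ^+ (2 * m))))%:C * expi (dotv w y - enorm w ^+ (2 * m)).
Proof.
rewrite /rot_integrand !mul0rn cexp0 mulr1 mul1r add0r /cexp.
by congr ((expR _)%:C * expi _); rewrite !(cReD, cImD, cReN, cImN, cReM, cImM)/=; ring.
Qed.

Lemma rot_integrand_zeta y e w :
  rot_integrand m y (Complex e 1) (Complex 0 (- rot_angle)) w =
  zeta ^+ N * (phase y w * cexp (Complex 0 (e * enorm w ^+ (2 * m)))).
Proof.
rewrite /rot_integrand /phase rot_angle_half cexp_mpihalf -/zeta.
rewrite -[zeta ^+ N]cexpMn -!cexpD; congr cexp.
rewrite -addrA; congr (_ + _); rewrite -addrA; congr (_ + _).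
  by rewrite /izeta -mulrA; congr (_ * _); rewrite Complex0 mulrC.
by apply: complexP; rewrite !(cReD, cImD, cReN, cImN, cReM, cImM)/=; ring.
Qed.

(* On the arc, Re((e + i) e^(-2 i m x)) = e cos(2mx) + sin(2mx) >= e. *)
Let adm e x : 0 < e < 2^-1 -> 0 <= x <= rot_angle ->
  admissible m (Complex e 1) e (Complex 0 (- x)).
Proof.
move=> /andP[e0 e1] /andP[x0 xt]; split => //.
have -> : Complex 0 (- x) *+ (2 * m) = Complex 0 (- ((2 * m)%:R * x)).
  rewrite Complex0 -mulrnAl -rmorphMn/= [in RHS]Complex0; congr (_%:C * _).
  by rewrite mulNrn mulr_natl.
set phi := _ * x.
have phi0 : 0 <= phi by rewrite mulr_ge0.
have phi1 : phi <= pi / 2.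
  apply: (@le_trans _ _ ((2 * m)%:R * rot_angle)); first by rewrite ler_wpM2l.
  rewrite le_eqVlt; apply/orP; left; apply/eqP.
  rewrite /rot_angle !natrM; by field; rewrite pnatr_eq0 -lt0n.
have pi0 := pi_gt0 R.
rewrite -expiE /expi cosN sinN cReM/= mul1r opprK.
have c0 : 0 <= cos phi.
  by apply: cos_ge0_pihalf; rewrite phi1 andbT; move: phi0 pi0; lra.
have s0 : 0 <= sin phi.
  by apply: sin_ge0_pi; rewrite phi0; move: phi1 pi0; lra.
have c1 := cos_le1 phi; have s1 := sin_le1 phi; have cs := cos2Dsin2 phi.
have : e * (cos phi ^+ 2 + sin phi ^+ 2) <= e * cos phi + sin phi.
  rewrite mulrDr; apply: lerD.
    by rewrite ler_wpM2l ?(ltW e0)// expr2 ler_piMr.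
  rewrite -[leRHS]mul1r; apply: ler_pM; rewrite ?sqr_ge0 ?(ltW e0)//.
    by move: e1; lra.
  by rewrite expr2 ler_piMr.
by rewrite cs mulr1.
Qed.

(** The normalization of the inverse Fourier transform times the Jacobian of the
    rotation. *)
Definition kernel_cst : R[i] := ((2 * pi) ^- N)%:C * zeta ^+ N.

Lemma phase_integrable (P : 'rV[R]_N -> R[i]) (C b : R) y : cmeasurable P ->
  (forall w, normc (P w) <= C * expR (b * enorm w)) ->
  cintegrable (fun w => P w * phase y w).
Proof.
move=> mP hP.
apply: (@cintegrable_le _ _ _ (fun w => C * weight m (b + norm1 y) 1 w)).
- by apply: cmeasurableM; [exact: mP|exact: cmeasurable_phase].
- by apply: rintegrableZ; exact: rintegrable_weight.
move=> w; rewrite Normc.normcM /weight mulrDl -addrA expRD mulrA.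
by rewrite ler_pM ?normc_ge0// normc_phase.
Qed.

(** The oscillatory integral defining the kernel becomes absolutely convergent
    once the contour is rotated by the angle pi/4m. *)
Lemma kernelF_phase y : kernelF m y = phase_integral (fun=> kernel_cst) y.
Proof.
have i1 : cintegrable (phase y).
  have := @phase_integrable (fun=> 1) 1 0 y (cmeasurable_cst _ _).
  rewrite (_ : (fun w => 1 * phase y w) = phase y); last first.
    by apply/funext => w; rewrite mul1r.
  by apply => w; rewrite Normc.normc1 mul0r expR0 mulr1.
rewrite /kernelF /phase_integral cintegralZ// /kernel_cst -mulrA.
congr (_ * _).
apply: (@complex_lim_at_right0 _ _ _
  (2 * (\int[lebesgue_rV N]_w (8 * weight m (norm1 y) 4^-1 w)))) => e e01.
have /andP[e0 e1] := e01.
have a2 : normc (Complex e 1) <= 2.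
  apply: le_trans (normc_le_Re_Im _) _; rewrite /= normr1 gtr0_norm//.
  by move: e1; lra.
have th0 : 0 <= rot_angle by rewrite divr_ge0// pi_ge0.
(* At the end of the rotation the damping [e] only contributes the factor
   e^(i e |w|^2m), of modulus one. *)
have := @rot_integral_const R N m hm y (Complex e 1) e e0 a2 rot_angle th0.
move=> /(_ (fun x hx => adm e01 hx)).
rewrite /rot_integral => rot.
rewrite (_ : (fun w => _ * expi _) = rot_integrand m y (Complex e 1) 0);
  last by apply/funext => w; rewrite rot_integrand0.
rewrite -rot {rot}.
have mE : cmeasurable (fun w => cexp (Complex 0 (e * enorm w ^+ (2 * m)))).
  apply: cmeasurable_cexp; apply: cmeasurable_imag.
  apply: measurable_funM; first exact: measurable_cst.
  by apply: measurable_funX; exact: measurable_enorm.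
have i2 : cintegrable (fun w => phase y w * cexp (Complex 0 (e * enorm w ^+ (2 * m)))).
  apply: (@cintegrable_le _ _ _ (fun w => weight m (norm1 y) 1 w)).
  - by apply: cmeasurableM; [exact: cmeasurable_phase|exact: mE].
  - exact: rintegrable_weight.
  by move=> w; rewrite Normc.normcM [normc (cexp _)]normc_cexp expR0 mulr1 normc_phase.
rewrite (_ : rot_integrand _ _ _ _ = fun w => zeta ^+ N *
    (phase y w * cexp (Complex 0 (e * enorm w ^+ (2 * m)))));
  last by apply/funext => w; rewrite rot_integrand_zeta.
rewrite cintegralZ// -mulrBr Normc.normcM normcX normc_zeta expr1n mul1r -cintegralB//.
apply: le_trans (normc_cintegral_le
  (h := fun w => e * (8 * weight m (norm1 y) 4^-1 w)) _ _ _) _.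
- apply: cmeasurableB; last exact: cmeasurable_phase.
  by apply: cmeasurableM; [exact: cmeasurable_phase|exact: mE].
- by do 2 apply: rintegrableZ; apply: rintegrable_weight => //; rewrite invr_gt0.
- move=> w; set q := enorm w ^+ (2 * m).
  have q0 : 0 <= q by rewrite exprn_ge0 ?enorm_ge0.
  rewrite -[X in _ - X]mulr1 -mulrBr Normc.normcM.
  have := normc_cexp_rem 1 (Complex 0 (e * q)).
  rewrite cexp_rem1 expr1.
  have -> : normc (Complex 0 (e * q)) = e * q.
    by rewrite /= expr0n/= add0r sqrtr_sqr ger0_norm// mulr_ge0// ltW.
  move=> h1.
  have q4 : q <= 4 * expR (q / 4).
    by rewrite -ler_pdivrMl// mulrC le_expR.
  have h2 : normc (cexp (Complex 0 (e * q)) - 1) <= 8 * e * expR (q * (3 / 4)).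
    apply: le_trans h1 _.
    have -> : q * (3 / 4) = q / 4 + q / 2 by lra.
    rewrite expRD.
    have -> : 8 * e * (expR (q / 4) * expR (q / 2)) =
      (2 * e * (4 * expR (q / 4))) * expR (q / 2) by ring.
    rewrite ler_pM ?expR_ge0 ?mulr_ge0 ?(ltW e0)//.
      by rewrite mulrA ler_wpM2l// mulr_ge0// ltW.
    by rewrite ler_expR mulrC ler_wpM2l// ltW.
  apply: le_trans (ler_pM (normc_ge0 _) (normc_ge0 _) (normc_phase y w) h2) _.
  rewrite /weight -/q.
  have -> : norm1 y * enorm w - 4^-1 * q =
    (norm1 y * enorm w - 1 * q) + q * (3 / 4) by lra.
  rewrite [X in _ <= e * (8 * X)]expRD le_eqVlt; apply/orP; left; apply/eqP; ring.
have i8 : rintegrable (fun w : 'rV[R]_N => 8 * weight m (norm1 y) 4^-1 w).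
  by apply: rintegrableZ; apply: rintegrable_weight => //; rewrite invr_gt0.
by rewrite (RintegralZl e measurableT i8) mulrCA mulrC.
Qed.

(** Exponential growth is the class of amplitudes that is stable under
    differentiation of the phase integral. *)
Definition exp_growth (P : 'rV[R]_N -> R[i]) := cmeasurable P /\
  exists C b, forall w, normc (P w) <= C * expR (b * enorm w).

Lemma exp_growth_cst c : exp_growth (fun=> c).
Proof.
split; first exact: cmeasurable_cst.
by exists (normc c), 0 => w; rewrite mul0r expR0 mulr1.
Qed.

Lemma exp_growth_coord i : exp_growth (fun w => izeta * (w ord0 i)%:C).
Proof.
split.
  apply: cmeasurableM; first exact: cmeasurable_cst.
  by apply: cmeasurable_real; exact: measurable_rV_coord.
exists 1, 1 => w; rewrite Normc.normcM normc_izeta !mul1r normc_real.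
exact: le_trans (coord_le_enorm _ _) (le_expR _).
Qed.

Lemma exp_growthM P Q : exp_growth P -> exp_growth Q ->
  exp_growth (fun w => P w * Q w).
Proof.
move=> [mP [C [b hP]]] [mQ [D [d hQ]]]; split; first exact: cmeasurableM.
exists (C * D), (b + d) => w.
by rewrite Normc.normcM mulrDl expRD mulrACA; apply: ler_pM; rewrite ?normc_ge0.
Qed.

Lemma exp_growthX P n : exp_growth P -> exp_growth (fun w => P w ^+ n).
Proof.
move=> eP; elim: n => [|n IH].
  by under eq_fun do rewrite expr0; exact: exp_growth_cst.
by under eq_fun do rewrite exprS; exact: exp_growthM.
Qed.

Lemma exp_growth_prod (I : Type) (r : seq I) (F : I -> 'rV[R]_N -> R[i]) :
  (forall i, exp_growth (F i)) -> exp_growth (fun w => \prod_(i <- r) F i w).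
Proof.
move=> eF; elim: r => [|i r IH].
  by under eq_fun do rewrite big_nil; exact: exp_growth_cst.
by under eq_fun do rewrite big_cons; exact: exp_growthM.
Qed.

Lemma phase_growth_integrable P y : exp_growth P ->
  cintegrable (fun w => P w * phase y w).
Proof. by move=> [mP [C [b hP]]]; exact: phase_integrable hP. Qed.

Lemma phase_shift i h y w : phase (h *: delta_mx ord0 i + y) w =
  phase y w * cexp (h%:C * (izeta * (w ord0 i)%:C)).
Proof.
rewrite /phase -cexpD; congr cexp.
have -> : dotv w (h *: delta_mx ord0 i + y) = h * w ord0 i + dotv w y.
  by rewrite dotvDr dotvZr dotv_delta.
rewrite rmorphD rmorphM/=; ring.
Qed.

(** Differentiating the phase in the direction i multiplies the amplitude by
    i zeta w_i; the error is controlled by the second order Taylor remainder. *)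
Lemma phase_integral_quadratic P i y : exp_growth P -> exists C, forall h,
  `|h| <= 1 ->
  normc (phase_integral P (h *: delta_mx ord0 i + y) - phase_integral P y -
    h%:C * phase_integral (fun w => P w * (izeta * (w ord0 i)%:C)) y) <=
  C * h ^+ 2.
Proof.
move=> gP; have [mP [C [b hP]]] := gP.
pose g w : R := 4 * C * weight m (b + norm1 y + 3) 1 w.
have ig : rintegrable g by apply: rintegrableZ; exact: rintegrable_weight.
have gPi : exp_growth (fun w => P w * (izeta * (w ord0 i)%:C)).
  by apply: exp_growthM => //; exact: exp_growth_coord.
exists (2 * \int[lebesgue_rV N]_w g w) => h h1.
rewrite /phase_integral.
rewrite -cintegralZ; last exact: phase_growth_integrable.
rewrite -cintegralB; [|exact: phase_growth_integrable|exact: phase_growth_integrable].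
rewrite -cintegralB; last 2 first.
- under eq_fun do rewrite -mulN1r.
  by apply: cintegrableD; [|apply: cintegrableZ]; exact: phase_growth_integrable.
- by apply: cintegrableZ; exact: phase_growth_integrable.
apply: le_trans (normc_cintegral_le (h := fun w => h ^+ 2 * g w) _ _ _) _.
- have mPp z : cmeasurable (fun w => P w * phase z w).
    by apply: cmeasurableM; [exact: mP|exact: cmeasurable_phase].
  apply: cmeasurableB; first by apply: cmeasurableB; exact: mPp.
  apply: cmeasurableM; first exact: cmeasurable_cst.
  by apply: cmeasurableM; [exact: gPi.1|exact: cmeasurable_phase].
- exact: rintegrableZ.
- move=> w; rewrite phase_shift; set X := h%:C * _.
  have -> : P w * (phase y w * cexp X) - P w * phase y w -
      h%:C * (P w * (izeta * (w ord0 i)%:C) * phase y w) =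
    (P w * phase y w) * (cexp X - 1 - X) by rewrite /X; ring.
  have X1 : normc X <= `|h| * enorm w.
    rewrite /X 2!Normc.normcM normc_izeta mul1r !normc_real.
    by apply: ler_wpM2l => //; exact: coord_le_enorm.
  have X2 : normc X <= enorm w.
    by apply: le_trans X1 _; rewrite ler_piMl// enorm_ge0.
  have := normc_cexp_rem 2 X.
  rewrite cexp_rem2.
  move=> r2; rewrite 2!Normc.normcM /g.
  have -> : h ^+ 2 * (4 * C * weight m (b + norm1 y + 3) 1 w) =
    (C * expR (b * enorm w)) * weight m (norm1 y) 1 w *
    (4 * h ^+ 2 * expR (enorm w) ^+ 3).
    rewrite /weight -expRM_natl.
    have -> : (b + norm1 y + 3) * enorm w - 1 * enorm w ^+ (2 * m) =
      b * enorm w + (norm1 y * enorm w - 1 * enorm w ^+ (2 * m)) + 3 * enorm w by ring.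
    rewrite !expRD; ring.
  apply: ler_pM; rewrite ?mulr_ge0 ?normc_ge0//.
    by apply: ler_pM; rewrite ?normc_ge0// normc_phase.
  apply: le_trans r2 _; rewrite [expR _ ^+ 3]exprSr mulrA; apply: ler_pM.
  - exact: sqr_ge0.
  - exact: expR_ge0.
  - rewrite exprMn -mulrA -natrX ler_wpM2l//.
    rewrite -[h ^+ 2]real_normK ?num_real// -exprMn lerXn2r ?nnegrE ?normc_ge0//.
    apply: le_trans X1 _; rewrite ler_wpM2l//; exact: le_expR.
  - by rewrite ler_expR.
by rewrite RintegralZl// mulrCA [C in _ <= C]mulrC.
Qed.

Lemma complex_partial_phase P i : exp_growth P ->
  complex_partial i (phase_integral P) =
  phase_integral (fun w => P w * (izeta * (w ord0 i)%:C)).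
Proof.
move=> gP; apply/funext => y.
have [C H] := phase_integral_quadratic i y gP.
exact: complex_partial_quadratic H.
Qed.

Definition rot_monomial (beta : 'I_N -> nat) w : R[i] :=
  \prod_i (izeta * (w ord0 i)%:C) ^+ beta i.

Lemma exp_growth_monomial beta : exp_growth (rot_monomial beta).
Proof. by apply: exp_growth_prod => i; apply: exp_growthX; exact: exp_growth_coord. Qed.

Lemma complex_Dmulti_phase beta P : exp_growth P ->
  complex_Dmulti beta (phase_integral P) =
  phase_integral (fun w => P w * rot_monomial beta w).
Proof.
move=> gP; rewrite /complex_Dmulti.
rewrite (_ : (fun w => P w * _) =
  fun w => P w * \prod_(i <- enum 'I_N) (izeta * (w ord0 i)%:C) ^+ beta i); last first.
  by apply/funext => w; rewrite /rot_monomial big_enum.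
elim: (enum 'I_N) => [|i s IH] /=.
  by congr phase_integral; apply/funext => w; rewrite big_nil mulr1.
rewrite IH.
have gs : exp_growth (fun w => P w * \prod_(i <- s) (izeta * (w ord0 i)%:C) ^+ beta i).
  apply: exp_growthM => //; apply: exp_growth_prod => j.
  by apply: exp_growthX; exact: exp_growth_coord.
have it n : iter n (complex_partial i)
    (phase_integral (fun w => P w * \prod_(i <- s) (izeta * (w ord0 i)%:C) ^+ beta i)) =
  phase_integral (fun w => (P w * \prod_(i <- s) (izeta * (w ord0 i)%:C) ^+ beta i) *
    (izeta * (w ord0 i)%:C) ^+ n).
  elim: n => [|n IHn].
    by congr phase_integral; apply/funext => w; rewrite expr0 mulr1.
  rewrite iterS IHn complex_partial_phase; last first.
    by apply: exp_growthM => //; apply: exp_growthX; exact: exp_growth_coord.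
  by congr phase_integral; apply/funext => w; rewrite [in RHS]exprSr [RHS]mulrA.
rewrite it; congr phase_integral; apply/funext => w.
by rewrite big_cons -mulrA [X in P w * X]mulrC.
Qed.

Definition kernel_D beta := phase_integral (fun w => kernel_cst * rot_monomial beta w).

Lemma complex_Dmulti_kernel beta : complex_Dmulti beta (kernelF m) = kernel_D beta.
Proof.
have -> : kernelF m = phase_integral (fun=> kernel_cst) by apply/funext; exact: kernelF_phase.
by rewrite complex_Dmulti_phase//; exact: exp_growth_cst.
Qed.

End kernel.

(** * Functions with exponential decay are determined by their moments *)

Section moment_determinacy.
Context {R : realType} {N : nat}.
Implicit Types (z : 'rV[R]_N) (g h v : 'rV[R]_N -> R) (A : set 'rV[R]_N).

Definition monomial (beta : 'I_N -> nat) z : R := \prod_i z ord0 i ^+ beta i.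

(** The closure of the polynomials under pointwise limits with exponential
    domination: a class of functions against which an exponentially decaying
    function with vanishing moments integrates to zero, and which is large enough
    to contain the indicators of all measurable sets. *)
Inductive poly_limit : ('rV[R]_N -> R) -> Prop :=
| poly_limit_monomial beta : poly_limit (monomial beta)
| poly_limitZ c g : poly_limit g -> poly_limit (fun z => c * g z)
| poly_limitD g h : poly_limit g -> poly_limit h ->
    poly_limit (fun z => g z + h z)
| poly_limit_lim (u : nat -> 'rV[R]_N -> R) g C b :
    (forall n, poly_limit (u n)) ->
    (forall n z, `|u n z| <= C * expR (b * enorm z)) ->
    (forall z, u n z @[n --> \oo] --> g z) -> poly_limit g.

Lemma monomial_le beta z :
  `|monomial beta z| <= expR ((\sum_i beta i)%N%:R * enorm z).
Proof.
rewrite normr_prod (expRM_natl _ (enorm z)) -prodrXr; apply: ler_prod => i _.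
rewrite normrX exprn_ge0//= lerXn2r ?nnegrE ?expR_ge0//.
exact: le_trans (coord_le_enorm z i) (le_expR _).
Qed.

Lemma measurable_monomial beta : measurable_fun setT (monomial beta).
Proof.
apply: measurable_prod => i _; apply: measurable_funX; exact: measurable_rV_coord.
Qed.

Lemma poly_limit_measurable g : poly_limit g -> measurable_fun setT g.
Proof.
elim=> {g} [beta|c g _ mg|g h _ mg _ mh|u g C b _ mu _ ug].
- exact: measurable_monomial.
- by apply: measurable_funM => //; exact: measurable_cst.
- exact: measurable_funD.
- by apply: (measurable_fun_cvg mu) => z _; exact: ug.
Qed.

Lemma limit_bound (u : nat -> R) (l B : R) : (forall n, `|u n| <= B) ->
  u n @[n --> \oo] --> l -> `|l| <= B.
Proof.
move=> uB ul; have nl : `|u n| @[n --> \oo] --> `|l| by exact: cvg_norm.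
rewrite -(cvg_lim (@Rhausdorff R) nl); apply: limr_le; first by apply: cvgP nl.
by apply: nearW.
Qed.

Lemma poly_limit_bound g : poly_limit g ->
  exists C b, forall z, `|g z| <= C * expR (b * enorm z).
Proof.
elim=> {g} [beta|c g _ [C [b gC]]|g h _ [C [b gC]] _ [D [d hD]]|u g C b _ _ uC ug].
- by exists 1, (\sum_i beta i)%N%:R => z; rewrite mul1r; exact: monomial_le.
- by exists (`|c| * C), b => z; rewrite normrM -mulrA ler_wpM2l.
- exists (`|C| + `|D|), (`|b| + `|d|) => z.
  apply: le_trans (ler_normD _ _) _; rewrite mulrDl.
  have le_ (c e f : R) : `|c| <= f ->
      e * expR (c * enorm z) <= `|e| * expR (f * enorm z).
    move=> cf; apply: (@le_trans _ _ (`|e| * expR (c * enorm z))).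
      by rewrite ler_wpM2r ?expR_ge0// ler_norm.
    rewrite ler_wpM2l// ler_expR ler_wpM2r ?enorm_ge0//.
    exact: le_trans (ler_norm c) cf.
  apply: lerD; first by apply: le_trans (gC z) (le_ _ _ _ _); rewrite lerDl.
  by apply: le_trans (hD z) (le_ _ _ _ _); rewrite lerDr.
- by exists C, b => z; apply: limit_bound (ug z) => n; exact: uC.
Qed.

Lemma poly_limit_ext g h : g =1 h -> poly_limit g -> poly_limit h.
Proof. by move=> /funext ->. Qed.

(** Induction on both derivations: exponential bounds multiply, so that products
    of dominated limits are dominated limits. *)
Lemma poly_limitM g h : poly_limit g -> poly_limit h ->
  poly_limit (fun z => g z * h z).
Proof.
move=> pg; elim: pg h => {g} [beta|c g _ IH|g1 g2 _ IH1 _ IH2|u g C b pu IH uC ug] h ph.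
- elim: ph => {h} [gamma|c h _ IH|h1 h2 _ IH1 _ IH2|u h C b pu IH uC uh].
  + apply: (poly_limit_ext _ (poly_limit_monomial (fun i => beta i + gamma i)%N)) => z.
    by rewrite /monomial -big_split/=; apply: eq_bigr => i _; rewrite exprD.
  + by apply: (poly_limit_ext _ (poly_limitZ c IH)) => z; rewrite mulrCA.
  + by apply: (poly_limit_ext _ (poly_limitD IH1 IH2)) => z; rewrite mulrDr.
  + apply: (poly_limit_lim (C := C) (b := (\sum_i beta i)%N%:R + b) IH) => [n z|z].
      rewrite normrM mulrDl expRD mulrCA; apply: ler_pM => //.
      exact: monomial_le.
    by apply: cvgM (uh z); exact: cvg_cst.
- by apply: (poly_limit_ext _ (poly_limitZ c (IH h ph))) => z; rewrite mulrA.
- by apply: (poly_limit_ext _ (poly_limitD (IH1 _ ph) (IH2 _ ph))) => z; rewrite mulrDl.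
- have [D [d hD]] := poly_limit_bound ph.
  apply: (poly_limit_lim (C := C * D) (b := b + d) (fun n => IH n h ph)) => [n z|z].
    by rewrite normrM mulrDl expRD mulrACA; apply: ler_pM.
  by apply: cvgM (ug z) _; exact: cvg_cst.
Qed.

Lemma poly_limit_cst c : poly_limit (fun=> c).
Proof.
apply: (poly_limit_ext _ (poly_limitZ c (poly_limit_monomial (fun=> 0%N)))) => z.
by rewrite /monomial big1 ?mulr1// => i _; rewrite expr0.
Qed.

Lemma poly_limitB g h : poly_limit g -> poly_limit h ->
  poly_limit (fun z => g z - h z).
Proof.
move=> pg ph; apply: (poly_limit_ext _ (poly_limitD pg (poly_limitZ (-1) ph))) => z.
by rewrite mulN1r.
Qed.

Lemma poly_limitX g n : poly_limit g -> poly_limit (fun z => g z ^+ n).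
Proof.
move=> pg; elim: n => [|n IH].
  exact: (poly_limit_ext _ (poly_limit_cst 1)).
by apply: (poly_limit_ext _ (poly_limitM pg IH)) => z; rewrite exprS.
Qed.

Lemma poly_limit_sum (F : nat -> 'rV[R]_N -> R) n : (forall k, poly_limit (F k)) ->
  poly_limit (fun z => \sum_(0 <= k < n) F k z).
Proof.
move=> pF; elim: n => [|n IH].
  by apply: (poly_limit_ext _ (poly_limit_cst 0)) => z; rewrite big_geq.
by apply: (poly_limit_ext _ (poly_limitD IH (pF n))) => z; rewrite big_nat_recr.
Qed.

Lemma poly_limit_coord i : poly_limit (fun z => z ord0 i).
Proof.
apply: (poly_limit_ext _ (poly_limit_monomial (fun j => (j == i) : nat))) => z.
rewrite /monomial (bigD1 i)//= eqxx expr1 big1 ?mulr1// => j /negbTE ->.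
by rewrite expr0.
Qed.

Lemma series_sin_coeff_le (x : R) n : `|series (sin_coeff x) n| <= expR `|x|.
Proof.
apply: le_trans (ler_norm_sum _ _ _) _.
apply: (@le_trans _ _ (series (exp_coeff `|x|) n)).
  apply: ler_sum => k _; rewrite /exp_coeff /sin_coeff /=.
  rewrite !normrM normfV !normr_nat !normrX normrN normr1 expr1n mulr1.
  by case: odd; [rewrite mul1r | rewrite !mul0r divr_ge0 ?exprn_ge0].
apply: nondecreasing_cvgn_le; last exact: is_cvg_series_exp_coeff.
by apply: nondecreasing_series => k _ _; rewrite divr_ge0 ?exprn_ge0.
Qed.

(** The partial sums of the sine series are dominated by exp|x|. *)
Lemma poly_limit_sin i (a c : R) : poly_limit (fun z => sin (a * z ord0 i + c)).
Proof.
have pu n : poly_limit (fun z => series (sin_coeff (a * z ord0 i + c)) n).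
  apply: poly_limit_sum => k.
  have p1 : poly_limit (fun z => (a * z ord0 i + c) ^+ k).
    apply: poly_limitX; apply: poly_limitD; last exact: poly_limit_cst.
    by apply: poly_limitZ; exact: poly_limit_coord.
  apply: (poly_limit_ext _ (poly_limitZ ((odd k)%:R * (-1) ^+ k.-1./2 / k`!%:R) p1)) => z.
  by rewrite /sin_coeff/= mulrAC.
apply: (poly_limit_lim (C := expR `|c|) (b := `|a|) pu) => [n z|z].
  apply: le_trans (series_sin_coeff_le _ _) _; rewrite -expRD ler_expR.
  apply: le_trans (ler_normD _ _) _; rewrite addrC lerD2l normrM.
  by rewrite ler_wpM2l// coord_le_enorm.
by rewrite unlock; exact: is_cvg_series_sin_coeff.
Qed.

(** The classical polynomial approximation of |x| on [-1, 1]. *)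
Fixpoint abs_approx (x : R) n : R :=
  if n is n'.+1 then
    let p := abs_approx x n' in p + (x ^+ 2 - p ^+ 2) / 2
  else 0.

Lemma abs_approx_bound x n : `|x| <= 1 ->
  0 <= abs_approx x n <= `|x| /\ `|x| - abs_approx x n <= `|x| * (1 - `|x| / 2) ^+ n.
Proof.
move=> x1; elim: n => [|n [/andP[p0 px] IH]] /=.
  by rewrite lexx normr_ge0 expr0 mulr1 subr0.
rewrite -[x ^+ 2]real_normK ?num_real//.
move: (abs_approx x n) p0 px IH => p p0 px IH.
have y0 := normr_ge0 x; set y := `|x| in x1 px IH y0 *.
have yp : y - (p + (y ^+ 2 - p ^+ 2) / 2) = (y - p) * (1 - (y + p) / 2) by field.
split.
  apply/andP; split; last by rewrite -subr_ge0 yp mulr_ge0//; lra.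
  by rewrite addr_ge0// divr_ge0// subr_ge0 lerXn2r ?nnegrE.
rewrite yp; apply: (@le_trans _ _ ((y - p) * (1 - y / 2))).
  by rewrite ler_wpM2l//; lra.
by rewrite exprSr mulrA ler_wpM2r//; lra.
Qed.

Lemma cvg_abs_approx x : `|x| <= 1 -> abs_approx x n @[n --> \oo] --> `|x|.
Proof.
move=> x1; have H n := abs_approx_bound n x1.
have [->|x0] := eqVneq x 0.
  rewrite normr0; rewrite (_ : abs_approx 0 = fun=> 0); first exact: cvg_cst.
  apply/funext => n; have [/andP[h0 h1] _] := H n.
  move: (abs_approx_bound n (x := 0)); rewrite normr0 => /(_ ler01)[/andP[? ?] _].
  by apply/eqP; rewrite eq_le; apply/andP.
have xp : 0 < `|x| by rewrite normr_gt0.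
apply: (@squeeze_cvgr _ _ _ _ (fun n => `|x| - `|x| * (1 - `|x| / 2) ^+ n) (fun=> `|x|)).
- by apply: nearW => n; have [/andP[h0 h1] h2] := H n; rewrite h1 andbT; lra.
- rewrite -[X in _ --> X]subr0; apply: cvgB; first exact: cvg_cst.
  rewrite -[X in _ --> X](mulr0 `|x|); apply: cvgM; first exact: cvg_cst.
  by apply: cvg_expr; rewrite ger0_norm; lra.
- exact: cvg_cst.
Qed.

Lemma poly_limit_abs g : poly_limit g -> (forall z, `|g z| <= 1) ->
  poly_limit (fun z => `|g z|).
Proof.
move=> pg g1; have pu n : poly_limit (fun z => abs_approx (g z) n).
  elim: n => [|n IH] /=; first exact: poly_limit_cst.
  apply: poly_limitD => //.
  have := poly_limitZ 2^-1 (poly_limitB (poly_limitX 2 pg) (poly_limitX 2 IH)).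
  by apply: poly_limit_ext => z; rewrite mulrC.
apply: (poly_limit_lim (C := 1) (b := 0) pu) => [n z|z]; last exact: cvg_abs_approx.
rewrite mul0r expR0 mulr1; have [/andP[h0 h1] _] := abs_approx_bound n (g1 z).
by rewrite ger0_norm// (le_trans h1).
Qed.

Lemma cvg_indic_neq0 (x : R) : `|x| <= 1 ->
  1 - (1 - x ^+ 2) ^+ n @[n --> \oo] --> ((x != 0)%:R : R).
Proof.
move=> x1; have [->|x0] := eqVneq x 0.
  rewrite expr0n/= subr0.
  under eq_fun do rewrite expr1n subrr; exact: cvg_cst.
rewrite -[X in _ --> X]subr0; apply: cvgB; first exact: cvg_cst.
apply: cvg_expr; rewrite -real_normK ?num_real//.
have xp : 0 < `|x| by rewrite normr_gt0.
have xx : 0 < `|x| ^+ 2 by rewrite exprn_gt0.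
have : `|x| ^+ 2 <= 1 by rewrite exprn_ile1.
by move: (`|x| ^+ 2) xx => t t0 t1; rewrite ger0_norm; lra.
Qed.

Lemma poly_limit_neq0 g : poly_limit g -> (forall z, `|g z| <= 1) ->
  poly_limit (fun z => (g z != 0)%:R).
Proof.
move=> pg g1.
have pu n : poly_limit (fun z => 1 - (1 - g z ^+ 2) ^+ n).
  apply: poly_limitB; first exact: poly_limit_cst.
  apply: poly_limitX; apply: poly_limitB; first exact: poly_limit_cst.
  exact: poly_limitX.
apply: (poly_limit_lim (C := 1) (b := 0) pu) => [n z|z]; last exact: cvg_indic_neq0.
rewrite mul0r expR0 mulr1.
have h1 : `|g z| ^+ 2 <= 1 by rewrite exprn_ile1.
rewrite real_normK ?num_real// in h1.
have h0 : 0 <= 1 - g z ^+ 2 by rewrite subr_ge0.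
have h2 : 0 <= (1 - g z ^+ 2) ^+ n by rewrite exprn_ge0.
have h3 : (1 - g z ^+ 2) ^+ n <= 1.
  by rewrite exprn_ile1// gerBl sqr_ge0.
by rewrite ger0_norm; lra.
Qed.

(** The positive part (|g| + g)/2 is nonzero exactly where g is positive. *)
Lemma poly_limit_pos g : poly_limit g -> (forall z, `|g z| <= 1) ->
  poly_limit (fun z => (0 < g z)%R%:R).
Proof.
move=> pg g1.
have p := poly_limitZ 2^-1 (poly_limitD (poly_limit_abs pg g1) pg).
apply: (poly_limit_ext _ (poly_limit_neq0 p _)) => z.
  congr (_%:R); have [g0|g0] := ltP 0 (g z).
    by rewrite gtr0_norm// mulf_neq0// gt_eqF// addr_gt0.
  by rewrite ler0_norm// addNr mulr0 eqxx.
apply: (@le_trans _ _ (2^-1 * (`|g z| + `|g z|))).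
  rewrite normrM ger0_norm// ler_wpM2l//.
  by apply: le_trans (ler_normD _ _) _; rewrite normr_id.
by have := g1 z; lra.
Qed.

(** For large n the sign of sin((z_i - x)/(n+1)) is that of z_i - x: this makes a
    bounded entire function separate half-spaces. *)
Lemma poly_limit_halfspace i (x : R) : poly_limit (fun z => (x < z ord0 i)%R%:R).
Proof.
pose u n z : R := (0 < sin (n.+1%:R^-1 * z ord0 i + - (n.+1%:R^-1 * x)))%R%:R.
have pu n : poly_limit (u n).
  apply: poly_limit_pos; first exact: poly_limit_sin.
  by move=> z; exact: sin_max.
apply: (poly_limit_lim (C := 1) (b := 0) pu) => [n z|z].
  rewrite mul0r expR0 mulr1 /u; case: ltP => _; by rewrite ?normr1 ?normr0.
apply: cvg_near_cst; near=> n.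
rewrite /u -mulrBr; set d := z ord0 i - x.
have n0 : 0 < n.+1%:R :> R by [].
have hn : `|d| < n.+1%:R.
  apply: lt_le_trans (Num.Theory.truncnS_gt _) _; rewrite ler_nat ltnS.
  by apply: ltnW; near: n; exact: nbhs_infty_gt.
have dn : `|n.+1%:R^-1 * d| < 1.
  by rewrite normrM ger0_norm// mulrC ltr_pdivrMr// mul1r.
have pi2 : 1 < pi :> R by have := @pihalf_ge1 R; lra.
have [xz|zx] := ltP x (z ord0 i).
  have d0 : 0 < n.+1%:R^-1 * d by rewrite mulr_gt0 ?invr_gt0// subr_gt0.
  rewrite sin_gt0_pi//; rewrite d0/=.
  by move: dn; rewrite gtr0_norm// => /lt_trans; apply.
have d0 : n.+1%:R^-1 * d <= 0.
  by rewrite mulr_ge0_le0// subr_le0.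
rewrite ltNge (_ : sin _ <= 0)//.
rewrite -oppr_ge0 -sinN; apply: sin_ge0_pi.
rewrite oppr_ge0 d0/=; move: dn; rewrite ler0_norm// => dn.
exact: ltW (lt_trans dn pi2).
Unshelve. all: by end_near. Qed.

Definition indic_poly_limit A := poly_limit (fun z => (z \in A)%:R).

(** A class stable under products and bounded limits contains the indicators of
    complements and countable unions. *)
Lemma sigma_algebra_indic_poly_limit : sigma_algebra setT indic_poly_limit.
Proof.
have C A : indic_poly_limit A -> indic_poly_limit (~` A).
  move=> pA; apply: (poly_limit_ext _ (poly_limitB (poly_limit_cst 1) pA)) => z.
  by rewrite in_setC; case: (z \in A); rewrite ?subrr ?subr0.
split.
- by apply: (poly_limit_ext _ (poly_limit_cst 0)) => z; rewrite in_set0.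
- by move=> A pA; rewrite setTD; exact: C.
move=> A pA; rewrite -[\bigcup_k A k]setCK; apply: (C _).
pose u n z : R := \prod_(k < n) (z \in ~` A k)%:R.
have uE n z : u n z = (z \in ~` (\bigcup_(k in `I_n) A k))%:R.
  rewrite /u; elim: n => [|n IH].
    by rewrite big_ord0 II0 bigcup_set0 setC0 in_setT.
  rewrite big_ord_recr/= IH -natrM mulnb -in_setI -setCU; congr ((z \in ~` _)%:R).
  by rewrite !bigcup_mkord big_ord_recr.
have pu n : poly_limit (u n).
  rewrite /u; elim: n => [|n IH].
    by apply: (poly_limit_ext _ (poly_limit_cst 1)) => z; rewrite big_ord0.
  apply: (poly_limit_ext _ (poly_limitM IH (C _ (pA n)))) => z.
  by rewrite big_ord_recr.
apply: (poly_limit_lim (C := 1) (b := 0) pu) => [n z|z].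
  rewrite mul0r expR0 mulr1 uE; case: (_ \in _); by rewrite ?normr1 ?normr0.
apply: cvg_near_cst; case: (boolP (z \in ~` (\bigcup_k A k))) => zA.
  apply: nearW => n; rewrite uE mem_set//; move: zA; rewrite inE => zA [k _ Ak].
  by apply: zA; exists k.
have [k _ Ak] : (\bigcup_k A k) z.
  by apply: contrapT => h; move/negP : zA; apply; rewrite inE.
near=> n; rewrite uE memNset// => h; apply: h; exists k => //=.
by near: n; exact: nbhs_infty_gt.
Unshelve. all: by end_near. Qed.

Lemma measurable_indic_poly_limit A : measurable A -> indic_poly_limit A.
Proof.
suff : @measurable _ 'rV[R]_N `<=` indic_poly_limit by exact.
apply: smallest_sub; first exact: sigma_algebra_indic_poly_limit.
have H i (B : set R) : measurable B -> indic_poly_limit ((fun z => z ord0 i) @^-1` B).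
  have [S0 SC SU] := sigma_algebra_indic_poly_limit; move=> mB.
  have {}mB : (<<s @RGenOInfty.G R >>) B.
    have E := congr1 (fun S : set (set R) => S B) (RGenOInfty.measurableE R).
    exact: (@eq_ind Prop _ (fun P : Prop => P) mB _ E).
  suff sub : <<s @RGenOInfty.G R >> `<=` [set B : set R |
    indic_poly_limit ((fun z => z ord0 i) @^-1` B)] by exact: sub.
  apply: smallest_sub.
    split => /=.
    - by rewrite preimage_set0.
    - by move=> B' /SC; rewrite !setTD.
    - by move=> F hF; rewrite preimage_bigcup; exact: SU.
  move=> _ [x ->] /=; apply: (poly_limit_ext _ (poly_limit_halfspace i x)) => z.
  by congr ((nat_of_bool _)%:R); apply/idP/idP; rewrite inE/= in_itv/= andbT.
elim/big_rec: _ => [//|i S _ IH] A' [[B mB <-]|]; last exact: IH.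
by rewrite setTI; exact: H.
Qed.

Section vanishing.
Variable v : 'rV[R]_N -> R.
Hypothesis mv : measurable_fun setT v.
Hypothesis iv : forall b, rintegrable (fun z => expR (b * enorm z) * `|v z|).

Lemma poly_limit_rintegrable g : poly_limit g -> rintegrable (fun z => g z * v z).
Proof.
move=> pg; have [C [b gC]] := poly_limit_bound pg.
apply: (rintegrable_le _ (rintegrableZ C (iv b))).
  by apply: measurable_funM => //; exact: poly_limit_measurable.
by move=> z; rewrite normrM mulrA ler_wpM2r.
Qed.

(** Dominated convergence propagates the vanishing of the moments. *)
Lemma poly_limit_integral0 g :
  (forall beta, \int[lebesgue_rV N]_z (monomial beta z * v z) = 0) ->
  poly_limit g -> \int[lebesgue_rV N]_z (g z * v z) = 0.
Proof.
move=> v0; elim=> {g} [//|c g pg IH|g h pg IHg ph IHh|u g C b pu IH uC ug].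
- under eq_Rintegral do rewrite -mulrA.
  by rewrite RintegralZl ?IH ?mulr0//; exact: poly_limit_rintegrable.
- under eq_Rintegral do rewrite mulrDl.
  by rewrite RintegralD ?IHg ?IHh ?addr0//; exact: poly_limit_rintegrable.
have pg : poly_limit g by exact: poly_limit_lim uC ug.
have mug n : measurable_fun setT (fun z => (u n z * v z)%:E).
  apply/measurable_EFinP; apply: measurable_funM => //.
  exact: poly_limit_measurable.
have mg : measurable_fun setT (fun z => (g z * v z)%:E).
  apply/measurable_EFinP; apply: measurable_funM => //.
  exact: poly_limit_measurable.
have cv : {ae lebesgue_rV N, forall z, setT z ->
    (u n z * v z)%:E @[n --> \oo] --> (g z * v z)%:E}.
  apply: aeW => z _; apply: cvg_EFin; first by apply: nearW.
  by apply: cvgM (ug z) _; exact: cvg_cst.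
have bd : {ae lebesgue_rV N, forall z n, setT z ->
    (`|(u n z * v z)%:E| <= (C * (expR (b * enorm z) * `|v z|))%:E)%E}.
  apply: aeW => z n _; rewrite lee_fin normrM mulrA.
  by rewrite ler_wpM2r.
have [_ _ H] := dominated_convergence measurableT mug mg cv
  (rintegrableZ C (iv b)) bd.
have e0 n : (\int[lebesgue_rV N]_z (u n z * v z)%:E = 0)%E.
  have fin := integrable_fin_num measurableT (poly_limit_rintegrable (pu n)).
  by rewrite -[LHS]fineK//; congr (_%:E); exact: IH.
have -> : \int[lebesgue_rV N]_z (g z * v z) =
    fine (\int[lebesgue_rV N]_z (g z * v z)%:E)%E by [].
rewrite -(cvg_lim (@ereal_hausdorff R) H).
by under eq_fun do rewrite e0; rewrite lim_cst.
Qed.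

(** A function with exponential decay whose moments all vanish is zero: its
    integral against its sign, a combination of indicators, vanishes. *)
Lemma moments_determine :
  (forall beta, \int[lebesgue_rV N]_z (monomial beta z * v z) = 0) ->
  {ae lebesgue_rV N, forall z, v z = 0}.
Proof.
move=> v0.
have mP : measurable [set z | 0 < v z].
  rewrite -[X in measurable X]setTI (_ : [set z | _] = v @^-1` `]0, +oo[%classic).
    exact: mv.
  by apply/seteqP; split => z /=; rewrite in_itv/= andbT.
pose g z : R := 2 * (z \in [set z | 0 < v z])%:R - 1.
have pg : poly_limit g.
  apply: poly_limitB; last exact: poly_limit_cst.
  by apply: poly_limitZ; exact: measurable_indic_poly_limit.
have gv z : g z * v z = `|v z|.
  rewrite /g; have [z0|z0] := ltP 0 (v z).
    by rewrite mem_set// mulr1 gtr0_norm//; lra.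
  by rewrite memNset/= ?mulr0 ?sub0r ?mulN1r ?ler0_norm//; apply/negP; rewrite -leNgt.
have := poly_limit_integral0 v0 pg; have := poly_limit_rintegrable pg.
have -> : (fun z => g z * v z) = (fun z => `|v z|) by apply/funext.
move=> ia i0.
have /(ae_eq_integral_abs _ measurableT) : measurable_fun setT (EFin \o v).
  exact/measurable_EFinP.
move=> /(_ (lebesgue_rV N)) [+ _].
have -> : (\int[lebesgue_rV N]_x `|(EFin \o v) x| = 0)%E.
  have fin := integrable_fin_num measurableT ia.
  by rewrite -[LHS]fineK//; congr (_%:E); exact: i0.
move=> /(_ erefl); apply: filterS => z /= /(_ I) [].
by [].
Qed.

End vanishing.

End moment_determinacy.

(** * Words, and the datum in the weighted space *)

Section words.
Context {N : nat}.

(** The multi-index counting the letters of a word; words replace multinomial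
    coefficients in the expansion of the powers of a sum. *)
Definition word_count k (f : {ffun 'I_k -> 'I_N}) (i : 'I_N) : nat :=
  #|[pred j | f j == i]|.

Lemma prod_word (T : comPzRingType) k (f : {ffun 'I_k -> 'I_N}) (x : 'I_N -> T) :
  \prod_j x (f j) = \prod_i x i ^+ word_count f i.
Proof.
rewrite (partition_big f predT)//=; apply: eq_bigr => i _.
rewrite (eq_bigr (fun=> x i)) => [|j /eqP <-//].
by rewrite prodr_const.
Qed.

Lemma exprn_sum_words (T : comPzRingType) (x : 'I_N -> T) k :
  (\sum_i x i) ^+ k =
  \sum_(f : {ffun 'I_k -> 'I_N}) \prod_i x i ^+ word_count f i.
Proof.
rewrite -[k in LHS]card_ord -prodr_const bigA_distr_bigA/=.
by apply: eq_bigr => f _; rewrite prod_word.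
Qed.

Lemma multi_length_word k (f : {ffun 'I_k -> 'I_N}) :
  multi_length (word_count f) = k.
Proof.
rewrite /multi_length -[RHS]card_ord -sum1_card (partition_big f predT)//=.
by apply: eq_bigr => i _; rewrite sum1_card.
Qed.

Lemma ex_word (beta : 'I_N -> nat) : exists f : {ffun 'I_(multi_length beta) -> 'I_N},
  word_count f =1 beta.
Proof.
pose s := flatten [seq nseq (beta i) i | i <- enum 'I_N].
have sz : size s = multi_length beta.
  rewrite size_flatten /shape -map_comp sumnE big_map big_enum/=.
  by apply: eq_bigr => i _; rewrite size_nseq.
pose t : (multi_length beta).-tuple 'I_N := Tuple (introT eqP sz).
exists [ffun j => tnth t j] => i.
have -> : word_count [ffun j => tnth t j] i = count_mem i s.
  rewrite /word_count -sum1_card -[s]/(tval t) -sum1_count.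
  rewrite (big_tuple _ _ t (pred1 i) (fun=> 1%N)).
  by apply: eq_bigl => j; rewrite !inE ffunE.
rewrite /s count_flatten -map_comp sumnE big_map big_enum/= (bigD1 i)//=.
rewrite count_nseq/= eqxx mul1n big1 ?addn0// => j ji.
by rewrite count_nseq/= (negbTE ji) mul0n.
Qed.

End words.

Section weighted_datum.
Context {R : realType} {N : nat} (m : nat) (hm : (1 <= m)%N).
Local Notation normc := Normc.normc.
Local Notation Re := complex.Re.
Local Notation Im := complex.Im.
Local Notation "x %:C" := (real_complex R x).
Implicit Types (y w z : 'rV[R]_N).

Definition alpha : R := (2 * m)%:R / (2 * m - 1)%:R.

Let m2 : (1 < 2 * m)%N. Proof. by rewrite mul2n; case: m hm. Qed.

Let m21 : (0 < 2 * m - 1)%N. Proof. by rewrite subn_gt0. Qed.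

Lemma alpha_ge1 : 1 <= alpha.
Proof. by rewrite /alpha ler_pdivlMr ?ltr0n// mul1r ler_nat leq_subr. Qed.

Lemma alpha_ge0 : 0 <= alpha. Proof. exact: le_trans alpha_ge1. Qed.

(** The exponents 2m and alpha are conjugate. *)
Lemma young (r b : R) : 0 <= r -> 0 <= b ->
  r * b <= 2^-1 * r ^+ (2 * m) + b `^ alpha.
Proof.
move=> r0 b0; have a0 : 0 < alpha by apply: lt_le_trans alpha_ge1.
have mp : 0 < (2 * m)%:R :> R by rewrite ltr0n ltnW.
have conj : ((2 * m)%:R)^-1 + alpha^-1 = 1.
  rewrite /alpha invf_div natrB; last exact: ltnW.
  by rewrite -[X in X + _]mul1r -mulrDl [X in X / _]addrC subrK divff ?gt_eqF.
apply: le_trans (conjugate_powR r0 b0 mp a0 conj) _; apply: lerD.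
  rewrite powR_mulrn// mulrC ler_wpM2r ?exprn_ge0//.
  by rewrite lef_pV2 ?posrE// ler_nat.
by rewrite ler_pdivrMr// ler_peMr ?powR_ge0// alpha_ge1.
Qed.

(** Since alpha > 1, any exponential is absorbed by a fraction of the weight. *)
Lemma enorm_absorbed (c : R) z : 0 <= c ->
  c * enorm z <= (8 * c) ^+ (2 * m) + 8^-1 * enorm z `^ alpha.
Proof.
move=> c0; have := young (mulr_ge0 (ler0n _ 8) c0) (enorm_ge0 z).
have : 0 <= (8 * c) ^+ (2 * m) by rewrite exprn_ge0// mulr_ge0.
lra.
Qed.

Lemma powR_alpha_add (a b : R) : 0 <= a -> 0 <= b ->
  (a + b) `^ alpha <= (2 * a) `^ alpha + (2 * b) `^ alpha.
Proof.
move=> a0 b0; have [ab|ba] := leP a b.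
  apply: (@le_trans _ _ ((2 * b) `^ alpha)); last by rewrite lerDr powR_ge0.
  by apply: ge0_ler_powR; rewrite ?nnegrE ?alpha_ge0 ?addr_ge0 ?mulr_ge0//; lra.
apply: (@le_trans _ _ ((2 * a) `^ alpha)); last by rewrite lerDl powR_ge0.
by apply: ge0_ler_powR; rewrite ?nnegrE ?alpha_ge0 ?addr_ge0 ?mulr_ge0//; lra.
Qed.

Lemma measurable_powR_enorm : measurable_fun setT (fun z : 'rV[R]_N => enorm z `^ alpha).
Proof.
exact: (measurableT_comp (measurable_powR alpha) measurable_enorm).
Qed.

Variable u0 : 'rV[R]_N -> R[i].
Hypothesis hu : L2_rho_star m u0.

Lemma cmeasurable_datum : cmeasurable u0. Proof. exact: hu.1. Qed.

Definition datum_weight z : R := expR (4^-1 * enorm z `^ alpha) * normc (u0 z).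

(** Cauchy-Schwarz (in the form 2ab <= a^2 + b^2) against the weight. *)
Lemma rintegrable_datum_weight : rintegrable datum_weight.
Proof.
have m4 : measurable_fun setT datum_weight.
  apply: measurable_funM; last exact/measurable_normc/cmeasurable_datum.
  apply: measurableT_comp => //; apply: measurable_funM => //.
  exact: measurable_powR_enorm.
have i1 : rintegrable (fun z => rho_star m z * normc (u0 z) ^+ 2).
  apply/integrableP; split.
    apply/measurable_EFinP; apply: measurable_funM.
      by apply: measurableT_comp => //; exact: measurable_powR_enorm.
    by apply: measurable_funX; exact/measurable_normc/cmeasurable_datum.
  apply: le_lt_trans hu.2; rewrite le_eqVlt; apply/orP; left; apply/eqP.
  apply: eq_integral => z _; rewrite /= ger0_norm//.
  by apply: mulr_ge0; [exact: expR_ge0|exact: sqr_ge0].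
have i2 : rintegrable (fun z : 'rV[R]_N => expR (2^-1) * expR (- (2^-1 * enorm z))).
  by apply: rintegrableZ; apply: rintegrable_expR_enorm; rewrite invr_gt0.
apply: (rintegrable_le m4 (rintegrableD i1 i2)) => z.
rewrite ger0_norm; last by rewrite mulr_ge0 ?expR_ge0 ?normc_ge0.
rewrite /datum_weight /rho_star -/alpha -expRD.
set t := enorm z `^ alpha; set U := normc (u0 z).
have te : enorm z - 1 <= t.
  have [h|h] := leP 1 (enorm z).
    apply: (@le_trans _ _ (enorm z)); first by rewrite gerBl.
    by rewrite -[leLHS]powRr1 ?enorm_ge0// ler_powR// alpha_ge1.
  by apply: (@le_trans _ _ 0); [rewrite subr_le0 ltW|exact: powR_ge0].
apply: (@le_trans _ _ (expR t * U ^+ 2 + expR (- (2^-1 * t)))); last first.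
  by rewrite lerD2l ler_expR; lra.
have e1 : expR t = expR (4^-1 * t) ^+ 4 by rewrite -expRM_natl; congr expR; lra.
have e2 : expR (- (2^-1 * t)) = expR (4^-1 * t) ^- 2.
  by rewrite expRN; congr (_^-1); rewrite -expRM_natl; congr expR; lra.
rewrite e1 e2; have : 0 < expR (4^-1 * t) by exact: expR_gt0.
move: (expR _) => e e0.
have : 0 <= (e ^+ 2 * U - e^-1) ^+ 2 by rewrite sqr_ge0.
have -> : (e ^+ 2 * U - e^-1) ^+ 2 = e ^+ 4 * U ^+ 2 - 2 * (e * U) + e ^- 2.
  by field; rewrite gt_eqF.
have : 0 <= e * U by apply: mulr_ge0; [exact: ltW|exact: normc_ge0].
lra.
Qed.

Lemma rintegrable_exp_datum b :
  rintegrable (fun z => expR (b * enorm z) * normc (u0 z)).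
Proof.
pose K := expR ((8 * `|b|) ^+ (2 * m)).
apply: (rintegrable_le _ (rintegrableZ K rintegrable_datum_weight)).
  apply: measurable_funM; last exact/measurable_normc/cmeasurable_datum.
  by apply: measurableT_comp => //; apply: measurable_funM => //; exact: measurable_enorm.
move=> z; rewrite ger0_norm; last by rewrite mulr_ge0 ?expR_ge0 ?normc_ge0.
rewrite /datum_weight mulrA ler_wpM2r ?normc_ge0// /K -expRD ler_expR.
apply: (@le_trans _ _ (`|b| * enorm z)).
  by rewrite ler_wpM2r ?enorm_ge0// ler_norm.
apply: le_trans (enorm_absorbed z (normr_ge0 b)) _; rewrite lerD2l.
by rewrite ler_wpM2r ?powR_ge0//; lra.
Qed.

Definition moment (beta : 'I_N -> nat) : R[i] :=
  complex_integral (fun z => (monomial beta z)%:C * u0 z).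

Lemma moment_integrable beta :
  cintegrable (fun z => (monomial beta z)%:C * u0 z).
Proof.
apply: cintegrable_le (rintegrable_exp_datum (\sum_i beta i)%N%:R) _.
  apply: cmeasurableM; last exact: cmeasurable_datum.
  by apply: cmeasurable_real; exact: measurable_monomial.
move=> z; rewrite Normc.normcM normc_real ler_wpM2r ?normc_ge0//.
exact: monomial_le.
Qed.

(** The moments of the real and imaginary parts are those of [u0]. *)
Lemma ex_moment_neq0 : ~ {ae lebesgue_rV N, forall z, u0 z = 0} ->
  exists beta, moment beta <> 0.
Proof.
move=> u0N; apply: contrapT => H; apply: u0N.
have M0 beta : moment beta = 0.
  by apply: contrapT => h; apply: H; exists beta.
have [mr mi] := cmeasurable_datum.
have ir b : rintegrable (fun z => expR (b * enorm z) * `|Re (u0 z)|).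
  apply: rintegrable_le (rintegrable_exp_datum b) _.
    apply: measurable_funM; last exact: measurableT_comp.
    by apply: measurableT_comp => //; apply: measurable_funM => //; exact: measurable_enorm.
  move=> z; rewrite normrM normr_id ger0_norm ?expR_ge0//.
  by rewrite ler_wpM2l ?expR_ge0// (normc_ge_Re_Im _).1.
have ii b : rintegrable (fun z => expR (b * enorm z) * `|Im (u0 z)|).
  apply: rintegrable_le (rintegrable_exp_datum b) _.
    apply: measurable_funM; last exact: measurableT_comp.
    by apply: measurableT_comp => //; apply: measurable_funM => //; exact: measurable_enorm.
  move=> z; rewrite normrM normr_id ger0_norm ?expR_ge0//.
  by rewrite ler_wpM2l ?expR_ge0// (normc_ge_Re_Im _).2.
have r0 : {ae lebesgue_rV N, forall z, Re (u0 z) = 0}.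
  apply: (moments_determine mr ir) => beta.
  have := congr1 (@Re R) (M0 beta); rewrite /= => <-.
  by apply: eq_Rintegral => z _; rewrite cReZ.
have i0 : {ae lebesgue_rV N, forall z, Im (u0 z) = 0}.
  apply: (moments_determine mi ii) => beta.
  have := congr1 (@Im R) (M0 beta); rewrite /= => <-.
  by apply: eq_Rintegral => z _; rewrite cImZ.
by apply: filterS2 r0 i0 => z zr zi; exact: complexP.
Qed.

End weighted_datum.

(** * Expansion of the convolution in powers of the scaling parameter *)

Section expansion.
Context {R : realType} {N : nat} (m : nat) (hm : (1 <= m)%N).
Local Notation normc := Normc.normc.
Local Notation "x %:C" := (real_complex R x).
Local Notation kc := (@kernel_cst R N m).
Implicit Types (y w z : 'rV[R]_N) (s : R).

Let X s z w : R[i] := (- s)%:C * (izeta m * (dotv w z)%:C).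

(** The Taylor remainder of [s |-> F(y - s z)] at 0, taken under the integral
    sign. *)
Definition kernel_rem n s y z : R[i] :=
  complex_integral (fun w => kc * phase m y w * cexp_rem n (X s z w)).

(** Up to (-s)^k/k!, the term of order k of the Taylor expansion of
    [F(y - s z)]. *)
Definition kernel_term k y z : R[i] :=
  \sum_(f : {ffun 'I_k -> 'I_N})
    (monomial (word_count f) z)%:C * kernel_D m (word_count f) y.

Let exp_growth_izeta z : exp_growth (fun w => izeta m * (dotv w z)%:C).
Proof.
split.
  by apply: cmeasurableM; [exact: cmeasurable_cst|exact: cmeasurable_dotv].
exists 1, (norm1 z) => w; rewrite Normc.normcM normc_izeta !mul1r normc_real.
by rewrite mulrC; apply: le_trans (dotv_le _ _) (le_expR _).
Qed.

Let izeta_dotvX z w k : (izeta m * (dotv w z)%:C) ^+ k =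
  \sum_(f : {ffun 'I_k -> 'I_N})
    (monomial (word_count f) z)%:C * rot_monomial m (word_count f) w.
Proof.
have -> : izeta m * (dotv w z)%:C =
    \sum_i (z ord0 i)%:C * (izeta m * (w ord0 i)%:C).
  rewrite /dotv rmorph_sum mulr_sumr; apply: eq_bigr => i _.
  by rewrite rmorphM/=; ring.
rewrite exprn_sum_words; apply: eq_bigr => f _.
rewrite /monomial rmorph_prod /rot_monomial -big_split/=; apply: eq_bigr => i _.
by rewrite exprMn rmorphXn.
Qed.

Let cst_growth : exp_growth (fun _ : 'rV[R]_N => kc).
Proof. exact: exp_growth_cst. Qed.

Let term_integrable k z y :
  cintegrable (fun w => kc * (izeta m * (dotv w z)%:C) ^+ k * phase m y w).
Proof.
by apply: phase_growth_integrable => //; apply: exp_growthM => //; exact: exp_growthX.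
Qed.

Lemma kernel_termE k y z : kernel_term k y z =
  complex_integral (fun w =>
    kc * (izeta m * (dotv w z)%:C) ^+ k * phase m y w).
Proof.
have gD f : cintegrable (fun w =>
    kc * rot_monomial m (@word_count N k f) w * phase m y w).
  by apply: phase_growth_integrable => //; apply: exp_growthM => //; exact: exp_growth_monomial.
rewrite /kernel_term (_ : (fun w => _) = (fun w => \sum_(f : {ffun 'I_k -> 'I_N})
    (monomial (word_count f) z)%:C *
    (kc * rot_monomial m (word_count f) w * phase m y w))).
  rewrite cintegral_sum => [|f]; last exact: cintegrableZ.
  by apply: eq_bigr => f _; rewrite cintegralZ.
apply/funext => w; rewrite izeta_dotvX mulr_sumr mulr_suml.
by apply: eq_bigr => f _; rewrite [kc * (_ * _)]mulrCA -!mulrA.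
Qed.

Let phaseB s y z w : phase m (y - s *: z) w = phase m y w * cexp (X s z w).
Proof.
rewrite /phase /X -cexpD; congr cexp.
by rewrite dotvDr dotvNr dotvZr rmorphD !rmorphN rmorphM/=; ring.
Qed.

Lemma kernelF_expansion n s y z : kernelF m (y - s *: z) =
  \sum_(k < n) ((- s) ^+ k / (k`!)%:R)%:C * kernel_term k y z + kernel_rem n s y z.
Proof.
have iP x : cintegrable (fun w => kc * phase m x w).
  by apply: phase_growth_integrable.
have E : (fun w => kc * phase m y w * cexp_rem n (X s z w)) =
   (fun w => kc * phase m (y - s *: z) w -
     \sum_(k < n) ((- s) ^+ k / (k`!)%:R)%:C *
       (kc * (izeta m * (dotv w z)%:C) ^+ k * phase m y w)).
  apply/funext => w; rewrite phaseB /cexp_rem mulrBr mulrA; congr (_ - _).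
  rewrite mulr_sumr; apply: eq_bigr => k _.
  rewrite /X exprMn rmorphM/= rmorphXn fmorphV rmorph_nat/=.
  by move: (_^-1) => c; ring.
rewrite /kernel_rem E cintegralB; last 2 first.
- exact: iP.
- by apply: cintegrable_sum => k; apply: cintegrableZ; exact: term_integrable.
rewrite cintegral_sum => [|k]; last by apply: cintegrableZ; exact: term_integrable.
have -> : \sum_(k < n) ((- s) ^+ k / (k`!)%:R)%:C * kernel_term k y z =
  \sum_(k < n) complex_integral (fun w => ((- s) ^+ k / (k`!)%:R)%:C *
       (kc * (izeta m * (dotv w z)%:C) ^+ k * phase m y w)).
  apply: eq_bigr => k _; rewrite kernel_termE; apply/esym.
  by apply: cintegralZ; exact: term_integrable.
by rewrite kernelF_phase// [RHS]addrC subrK.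
Qed.

Let normcX s z w : 0 <= s -> normc (X s z w) <= s * (enorm w * norm1 z).
Proof.
move=> s0; rewrite /X 2!Normc.normcM normc_izeta mul1r !normc_real normrN.
by rewrite (ger0_norm s0) ler_wpM2l// dotv_le.
Qed.

(** Uniform control of the Taylor remainder: by Young's inequality the growth
    exp(r b - r^2m) of the integrand costs exp(b^alpha), which for small s is an
    arbitrarily small fraction of the weight carried by the datum. *)
Lemma kernel_rem_le n (Y : R) : 0 <= Y -> exists2 C : R, 0 <= C &
  forall s y z, 0 <= s -> 16 * s * N%:R <= 1 -> norm1 y <= Y ->
  normc (kernel_rem n s y z) <= C * s ^+ n * expR (4^-1 * enorm z `^ alpha m).
Proof.
move=> Y0; (* The summand [2 * n] absorbs the factor (2r)^n of the remainder. *)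
pose A : R := Y + (2 * n)%:R.
have A0 : 0 <= A by rewrite addr_ge0.
pose I0 : R := \int[lebesgue_rV N]_w (weight m 0 2^-1 w).
have iI : rintegrable (@weight R N m 0 2^-1).
  by apply: rintegrable_weight => //; rewrite invr_gt0.
have I00 : 0 <= I0 by apply: Rintegral_ge0 => w _; exact: weight_ge0.
pose c : R := normc kc.
have c0 : 0 <= c by exact: normc_ge0.
pose B := (8 * (n * N)%:R) ^+ (2 * m) : R.
exists (2 * (c * expR ((2 * A) `^ alpha m + B) * I0)).
  by rewrite !mulr_ge0 ?expR_ge0.
move=> s y z s0 sN yY.
pose b := s * norm1 z.
have b0 : 0 <= b by rewrite mulr_ge0 ?norm1_ge0.
have h w : normc (kc * phase m y w * cexp_rem n (X s z w)) <=
    c * b ^+ n * expR ((A + b) `^ alpha m) * weight m 0 2^-1 w.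
  rewrite 2!Normc.normcM -/c.
  have r0 := enorm_ge0 w; set r := enorm w in r0 *.
  have Xb : normc (X s z w) <= r * b.
    by apply: le_trans (normcX z w s0) _; rewrite /b mulrCA.
  have r1 : normc (cexp_rem n (X s z w)) <= b ^+ n * expR ((2 * n)%:R * r + r * b).
    apply: le_trans (normc_cexp_rem _ _) _.
    rewrite expRD mulrA; apply: ler_pM.
    - by rewrite exprn_ge0// mulr_ge0 ?normc_ge0.
    - exact: expR_ge0.
    - rewrite mulnC natrM -mulrA expRM_natl -exprMn lerXn2r ?nnegrE//.
      + by rewrite mulr_ge0 ?normc_ge0.
      + by rewrite mulr_ge0 ?expR_ge0.
      + apply: (@le_trans _ _ (2 * (r * b))); first by rewrite ler_wpM2l.
        by rewrite mulrA [b * _]mulrC ler_wpM2r// le_expR.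
    - by rewrite ler_expR.
  have ph : normc (phase m y w) <= expR (r * Y - r ^+ (2 * m)).
    apply: le_trans (normc_phase m y w) _; rewrite /weight ler_expR mul1r lerB//.
    by rewrite mulrC ler_wpM2l.
  have := young hm r0 (addr_ge0 A0 b0) => yg.
  apply: (@le_trans _ _ (c * expR (r * Y - r ^+ (2 * m)) *
      (b ^+ n * expR ((2 * n)%:R * r + r * b)))).
    apply: ler_pM; rewrite ?mulr_ge0 ?normc_ge0//.
    by rewrite ler_wpM2l.
  have -> : c * expR (r * Y - r ^+ (2 * m)) * (b ^+ n * expR ((2 * n)%:R * r + r * b)) =
     c * b ^+ n * expR (r * (A + b) - r ^+ (2 * m)).
    have -> : r * (A + b) - r ^+ (2 * m) =
      (r * Y - r ^+ (2 * m)) + ((2 * n)%:R * r + r * b) by rewrite /A; ring.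
    by rewrite [in RHS]expRD; ring.
  rewrite -[leRHS]mulrA -expRD ler_wpM2l//; first by rewrite mulr_ge0 ?exprn_ge0.
  rewrite ler_expR mul0r sub0r -/r; lra.
apply: le_trans (normc_cintegral_le (h := fun w =>
  c * b ^+ n * expR ((A + b) `^ alpha m) * weight m 0 2^-1 w) _ _ h) _.
- apply: cmeasurableM.
    by apply: cmeasurableM; [exact: cmeasurable_cst|exact: cmeasurable_phase].
  have mX : cmeasurable (X s z).
    apply: cmeasurableM; first exact: cmeasurable_cst.
    exact: (exp_growth_izeta z).1.
  apply: cmeasurableB; first exact: cmeasurable_cexp.
  apply: cmeasurable_sum => k; apply: cmeasurableM; first exact: cmeasurableX.
  exact: cmeasurable_cst.
- exact: rintegrableZ.
rewrite RintegralZl// -/I0.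
have e1 : (2 * b) `^ alpha m <= 8^-1 * enorm z `^ alpha m.
  (* This is where smallness of [s] is used. *)
  have b8 : 2 * b <= 8^-1 * enorm z.
    have := norm1_le_enorm z => nz.
    have := ler_wpM2l s0 nz; rewrite -/b => bz.
    have := ler_wpM2r (enorm_ge0 z) sN; rewrite mul1r => sz.
    lra.
  apply: (@le_trans _ _ ((8^-1 * enorm z) `^ alpha m)).
    apply: ge0_ler_powR => //; rewrite ?nnegrE ?alpha_ge0//.
    - by rewrite mulr_ge0.
    - by rewrite mulr_ge0 ?enorm_ge0.
  rewrite powRM ?enorm_ge0// ler_wpM2r ?powR_ge0//.
  rewrite -[leRHS]powRr1//; apply: ger_powR; last exact: alpha_ge1.
  by apply/andP; split; lra.
have e2 : norm1 z ^+ n <= expR (B + 8^-1 * enorm z `^ alpha m).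
  apply: (@le_trans _ _ (expR ((n * N)%:R * enorm z))).
    rewrite natrM -mulrA expRM_natl lerXn2r ?nnegrE ?norm1_ge0 ?expR_ge0//.
    exact: le_trans (norm1_le_enorm z) (le_expR _).
  by rewrite ler_expR; exact: enorm_absorbed.
have e3 : (A + b) `^ alpha m <= (2 * A) `^ alpha m + 8^-1 * enorm z `^ alpha m.
  by apply: le_trans (powR_alpha_add hm A0 b0) _; rewrite lerD2l.
set t := enorm z `^ alpha m in e1 e2 e3 *.
have e4 : b ^+ n * expR ((A + b) `^ alpha m) <=
    s ^+ n * (expR ((2 * A) `^ alpha m + B) * expR (4^-1 * t)).
  rewrite /b exprMn -mulrA ler_wpM2l ?exprn_ge0//.
  apply: (@le_trans _ _ (expR (B + 8^-1 * t) * expR ((2 * A) `^ alpha m + 8^-1 * t))).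
    apply: ler_pM => //; rewrite ?exprn_ge0 ?norm1_ge0 ?expR_ge0//.
    by rewrite ler_expR.
  by rewrite -!expRD ler_expR; lra.
have := ler_wpM2l (mulr_ge0 (mulr_ge0 (ler0n R 2) c0) I00) e4.
set u := b ^+ n * _; set v := expR (_ + B) * _ => hh.
apply: le_trans (le_trans _ hh) _; rewrite le_eqVlt; apply/orP; left; apply/eqP.
  by rewrite /u; ring.
by rewrite /v; ring.
Qed.

(** Joint measurability in (z, w) makes this a parameter integral. *)
Lemma cmeasurable_kernel_rem n s y : cmeasurable (kernel_rem n s y).
Proof.
pose G (p : 'rV[R]_N * 'rV[R]_N) : R[i] :=
  kc * phase m y p.2 * cexp_rem n (X s p.1 p.2).
suff mG : cmeasurable G by exact: (cmeasurable_cintegral mG).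
have m2 : measurable_fun setT (@snd 'rV[R]_N 'rV[R]_N) by exact: measurable_snd.
have m1 : measurable_fun setT (@fst 'rV[R]_N 'rV[R]_N) by exact: measurable_fst.
have [p1 p2] := @cmeasurable_phase R N m y.
apply: cmeasurableM.
  apply: cmeasurableM; first exact: cmeasurable_cst.
  by split; [exact: (measurableT_comp p1 m2)|exact: (measurableT_comp p2 m2)].
have mX : cmeasurable (fun p : 'rV[R]_N * 'rV[R]_N => X s p.1 p.2).
  apply: cmeasurableM; first exact: cmeasurable_cst.
  apply: cmeasurableM; first exact: cmeasurable_cst.
  by apply: cmeasurable_real; exact: measurable_dotv.
apply: cmeasurableB; first exact: cmeasurable_cexp.
apply: cmeasurable_sum => k; apply: cmeasurableM; first exact: cmeasurableX.
exact: cmeasurable_cst.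
Qed.

Section datum.
Variable u0 : 'rV[R]_N -> R[i].
Hypothesis hu : L2_rho_star m u0.

Definition moment_term k y : R[i] := \sum_(f : {ffun 'I_k -> 'I_N})
  moment u0 (word_count f) * kernel_D m (word_count f) y.

(** The Taylor expansion of the kernel integrated against the datum: the
    coefficients are the moments, and the remainder stays of order s^n because
    [kernel_rem_le] leaves a function integrable against [u0]. *)
Lemma convolution_expansion n (Y : R) : 0 <= Y -> exists2 C : R, 0 <= C &
  forall s y, 0 <= s -> 16 * s * N%:R <= 1 -> norm1 y <= Y ->
  normc (complex_integral (fun z => kernelF m (y - s *: z) * u0 z) -
    \sum_(k < n) ((- s) ^+ k / (k`!)%:R)%:C * moment_term k y) <= C * s ^+ n.
Proof.
move=> Y0; have [C C0 HC] := kernel_rem_le n Y0.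
have iW := rintegrable_datum_weight hm hu.
pose I0 : R := \int[lebesgue_rV N]_z datum_weight m u0 z.
have I00 : 0 <= I0.
  by apply: Rintegral_ge0 => z _; apply: mulr_ge0; [exact: expR_ge0|exact: normc_ge0].
exists (2 * (C * I0)); first by rewrite !mulr_ge0.
move=> s y s0 sN yY.
have mr : cmeasurable (fun z => kernel_rem n s y z * u0 z).
  by apply: cmeasurableM; [exact: cmeasurable_kernel_rem|exact: cmeasurable_datum hu].
have br z : normc (kernel_rem n s y z * u0 z) <= C * s ^+ n * datum_weight m u0 z.
  rewrite Normc.normcM /datum_weight mulrA.
  by apply: ler_wpM2r; [exact: normc_ge0|exact: HC].
have irem : cintegrable (fun z => kernel_rem n s y z * u0 z).
  exact: cintegrable_le mr (rintegrableZ _ iW) br.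
pose T k z : R[i] := ((- s) ^+ k / (k`!)%:R)%:C *
   \sum_(f : {ffun 'I_k -> 'I_N}) kernel_D m (word_count f) y *
      ((monomial (word_count f) z)%:C * u0 z).
have iT k : cintegrable (T k).
  apply: cintegrableZ; apply: cintegrable_sum => f; apply: cintegrableZ.
  exact: moment_integrable hu _.
have E : (fun z => kernelF m (y - s *: z) * u0 z) =
    (fun z => \sum_(k < n) T k z + kernel_rem n s y z * u0 z).
  apply/funext => z; rewrite (kernelF_expansion n) mulrDl; congr (_ + _).
  rewrite mulr_suml; apply: eq_bigr => k _; rewrite /T /kernel_term -mulrA.
  congr (_ * _); rewrite mulr_suml; apply: eq_bigr => f _.
  by rewrite mulrAC mulrC.
rewrite E cintegralD//; last exact: cintegrable_sum.
rewrite cintegral_sum//.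
have -> : \sum_(k < n) complex_integral (T k) =
   \sum_(k < n) ((- s) ^+ k / (k`!)%:R)%:C * moment_term k y.
  apply: eq_bigr => k _; rewrite cintegralZ; last first.
    by apply: cintegrable_sum => f; apply: cintegrableZ; exact: moment_integrable hu _.
  congr (_ * _); rewrite cintegral_sum => [|f]; last first.
    by apply: cintegrableZ; exact: moment_integrable hu _.
  apply: eq_bigr => f _; rewrite cintegralZ; last exact: moment_integrable hu _.
  by rewrite mulrC.
rewrite [X in X - _]addrC addrK.
apply: le_trans (normc_cintegral_le mr (rintegrableZ _ iW) br) _.
by rewrite RintegralZl// -/I0 le_eqVlt; apply/orP; left; apply/eqP; ring.
Qed.

(** The coefficient of psi_beta is a nonzero multiple of the moment of order
    beta: there is a word with letter counts beta. *)
Lemma nontrivial_moment_term l beta0 : multi_length beta0 = l ->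
  moment u0 beta0 <> 0 ->
  nontrivial_combination m l
    (fun y => ((-1) ^+ l / (l`!)%:R)%:C * moment_term l y).
Proof.
move=> lb Mb.
pose mi (beta : {ffun 'I_N -> 'I_l.+1}) : 'I_N -> nat := fun i => nat_of_ord (beta i).
pose code (f : {ffun 'I_l -> 'I_N}) : {ffun 'I_N -> 'I_l.+1} :=
  [ffun i => inord (word_count f i)].
have codeE f : mi (code f) = word_count f.
  apply/funext => i; rewrite /mi ffunE inordK// ltnS.
  by rewrite /word_count; apply: leq_trans (max_card _) _; rewrite card_ord.
pose nw beta : nat := #|[pred f | code f == beta]|.
pose c (beta : {ffun 'I_N -> 'I_l.+1}) : R[i] :=
  (Num.sqrt (multi_fact (mi beta))%:R / (l`!)%:R * (nw beta)%:R)%:C * moment u0 (mi beta).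
have fact_pos beta : 0 < Num.sqrt (multi_fact (mi beta))%:R :> R.
  by rewrite sqrtr_gt0 ltr0n prodn_gt0// => i; exact: fact_gt0.
exists (finfun c); split.
  move: lb; have [f fb] := ex_word beta0 => lb; subst l.
  have ef : mi (code f) = beta0 by rewrite codeE; apply/funext.
  exists (code f); first by rewrite -[LHS]/(multi_length (mi (code f))) ef.
  rewrite ffunE /c => /eqP; rewrite mulf_eq0 => /orP[|/eqP]; last by rewrite ef.
  rewrite -(rmorph0 (real_complex R)) => /eqP/complexI/eqP; apply/negP.
  rewrite gt_eqF// mulr_gt0 ?divr_gt0 ?ltr0n ?fact_gt0//.
  by apply/card_gt0P; exists f; rewrite inE.
move=> y; rewrite /moment_term.
rewrite (partition_big code (fun beta => multi_length (mi beta) == l))/=; last first.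
  by move=> f _; rewrite codeE multi_length_word.
rewrite mulr_sumr; apply: eq_bigr => beta /eqP bl.
rewrite (eq_bigr (fun=> moment u0 (mi beta) * kernel_D m (mi beta) y)); last first.
  by move=> f /eqP <-; rewrite codeE.
rewrite sumr_const -[#|_|]/(nw beta) ffunE /c /psi complex_Dmulti_kernel// bl.
have nwE (x : R[i]) : x *+ nw beta = ((nw beta)%:R)%:C * x.
  by rewrite rmorph_nat mulr_natl.
rewrite nwE [RHS]mulrACA -rmorphM/=.
have -> : Num.sqrt (multi_fact (mi beta))%:R / (l`!)%:R * (nw beta)%:R *
  ((-1) ^+ l / Num.sqrt (multi_fact (mi beta))%:R) =
  (-1) ^+ l / (l`!)%:R * (nw beta)%:R :> R.
  by field; rewrite pnatr_eq0 -lt0n fact_gt0 gt_eqF.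
by rewrite mulrA -rmorphM.
Qed.

End datum.

End expansion.

(** * The asymptotic profile *)

Section scaling_exponents.
Context {R : realType}.

Lemma norm1_compact N (K : set 'rV[R]_N) : compact K ->
  exists2 Y : R, 0 <= Y & forall y, K y -> norm1 y <= Y.
Proof.
move=> /compact_bounded [M [_ hM]].
have M0 : 0 <= `|M| + 1 by rewrite addr_ge0.
exists (N%:R * (`|M| + 1)) => [|y Ky]; first by rewrite mulr_ge0.
have yM : `|y| <= `|M| + 1.
  by apply: (hM _ _ y Ky); apply: le_lt_trans (ler_norm M) _; rewrite ltrDl.
have c i : `|y ord0 i| <= `|M| + 1.
  apply: le_trans yM; rewrite /Num.norm/= mx_normE.
  exact: (le_bigmax _ (fun j : 'I_1 * 'I_N => `|y j.1 j.2|%:nng) (ord0, i)).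
apply: le_trans (ler_sum _ (fun i _ => c i)) _.
by rewrite sumr_const card_ord mulr_natl.
Qed.

Lemma near_pinfty_powRN (p e : R) : 0 < p -> 0 < e ->
  \forall t \near +oo, t `^ (- p) <= e.
Proof.
move=> p0 e0; near=> t.
have t0 : 0 < t by near: t; exact: nbhs_pinfty_gt.
have te : (e^-1) `^ (p^-1) <= t by near: t; exact: nbhs_pinfty_ge.
rewrite powRN -[leRHS]invrK lef_pV2 ?posrE ?powR_gt0 ?invr_gt0//.
have -> : e^-1 = ((e^-1) `^ (p^-1)) `^ p.
  by rewrite -powRrM mulVf ?gt_eqF// powRr1// invr_ge0 ltW.
by apply: ge0_ler_powR => //; rewrite ?nnegrE ?powR_ge0// ltW.
Unshelve. all: by end_near. Qed.

Lemma big_ord_last (V : nmodType) (F : nat -> V) l :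
  (forall k, (k < l)%N -> F k = 0) -> \sum_(k < l.+1) F k = F l.
Proof. by move=> F0; rewrite big_ord_recr big1 /= ?add0r// => k _; exact: F0. Qed.

Lemma signed_term (s : R) l (M : R[i]) :
  (((- s) ^+ l / (l`!)%:R)%:C)%C * M =
  ((s ^+ l)%:C)%C * ((((-1) ^+ l / (l`!)%:R)%:C)%C * M).
Proof.
by rewrite [RHS]mulrA -rmorphM (exprNn s l); congr ((_%:C)%C * _); rewrite -!mulrA mulrCA.
Qed.

Lemma normc_rescale (s C : R) l (j f : R[i]) : 0 < s ->
  Normc.normc (j - ((s ^+ l)%:C)%C * f) <= C * s ^+ l.+1 ->
  Normc.normc ((((s ^+ l)^-1)%:C)%C * j - f) <= C * s.
Proof.
move=> s0 h; have sl : s ^+ l != 0 by rewrite expf_eq0 (gt_eqF s0) andbF.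
have -> : (((s ^+ l)^-1)%:C)%C * j - f =
    (((s ^+ l)^-1)%:C)%C * (j - ((s ^+ l)%:C)%C * f).
  by rewrite mulrBr [in RHS]mulrA -rmorphM/= mulVf// rmorph1 mul1r.
rewrite Normc.normcM normc_real ger0_norm; last by rewrite invr_ge0 exprn_ge0// ltW.
rewrite mulrC ler_pdivrMr ?exprn_gt0//; apply: le_trans h _.
by rewrite exprS mulrA.
Qed.

Lemma solutionE N m (u0 : 'rV[R]_N -> R[i]) x t : solution m u0 x t =
  ((t `^ (- (N%:R / (2 * m)%:R)))%:C)%C *
  complex_integral (fun z => kernelF m
    (t `^ (- (1 / (2 * m)%:R)) *: x - t `^ (- (1 / (2 * m)%:R)) *: z) * u0 z).
Proof.
have E : (fun z => kernelF m (t `^ (- (1 / (2 * m)%:R)) *: (x - z)) * u0 z) =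
    (fun z => kernelF m
      (t `^ (- (1 / (2 * m)%:R)) *: x - t `^ (- (1 / (2 * m)%:R)) *: z) * u0 z).
  exact: (funext (fun z => congr1 (fun v => kernelF m v * u0 z) (scalerBr _ _ _))).
exact: (congr1 (fun f => ((t `^ (- (N%:R / (2 * m)%:R)))%:C)%C * complex_integral f) E).
Qed.

End scaling_exponents.

Theorem theorem5p1 (R : realType) (m N : nat) (hm : (1 <= m)%N)
    (hN : (1 <= N)%N) (u0 : 'rV[R]_N -> R[i]) (u0_L2 : L2_rho_star m u0)
    (u0_neq0 : ~ {ae lebesgue_rV N, forall y, u0 y = 0}) :
  exists (l : nat) (phi : 'rV[R]_N -> R[i]),
    nontrivial_combination m l phi /\
    exists r : 'rV[R]_N -> R -> R[i],
      (forall (x : 'rV[R]_N) (t : R), 0 < t ->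
         solution m u0 x t =
         ((t `^ (- ((N + l)%:R / (2 * m)%:R)))%:C)%C *
         (phi (t `^ (- (1 / (2 * m)%:R)) *: x) + r x t)) /\
      (forall K : set 'rV[R]_N, compact K ->
         exists C : R, \forall t \near +oo, forall x : 'rV[R]_N,
           K (t `^ (- (1 / (2 * m)%:R)) *: x) ->
           Normc.normc (r x t) <= C * t `^ (- (1 / (2 * m)%:R))).
Proof.
have [beta0 Mb0] := ex_moment_neq0 hm u0_L2 u0_neq0.
pose good n := `[< exists beta : 'I_N -> nat,
  multi_length beta = n /\ moment u0 beta <> 0 >].
have exg : exists n, good n.
  by exists (multi_length beta0); apply/asboolP; exists beta0.
(* The profile is carried by the lowest order at which a moment survives. *)
have [l /asboolP[beta [bl Mb]] lmin] := ex_minnP exg.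
have lower k y : (k < l)%N -> moment_term m u0 k y = 0.
  move=> kl; rewrite /moment_term big1// => f _.
  suff -> : moment u0 (word_count f) = 0 by rewrite mul0r.
  apply: contrapT => Mf; have : good k.
    by apply/asboolP; exists (word_count f); rewrite multi_length_word.
  by move/lmin; rewrite leqNgt kl.
pose phi y := ((((-1) ^+ l / (l`!)%:R : R)%:C)%C * moment_term m u0 l y).
exists l, phi; split; first exact: nontrivial_moment_term bl Mb.
clear Mb Mb0 u0_neq0.
pose p : R := 1 / (2 * m)%:R.
have m0 : 0 < (2 * m)%:R :> R by rewrite ltr0n muln_gt0.
have p0 : 0 < p by rewrite divr_gt0.
pose sol x t := solution m u0 x t.
(* The remainder is defined by the identity it has to satisfy. *)
exists (fun x t => ((t `^ ((N + l)%:R / (2 * m)%:R))%:C)%C * sol x t -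
  phi (t `^ (- p) *: x)); split.
  move=> x t t0; rewrite [phi _ + _]addrC subrK mulrA -rmorphM/=.
  by rewrite powRN mulVf ?mul1r// gt_eqF// powR_gt0.
move=> K /norm1_compact[Y Y0 KY].
have [C C0 HC] := convolution_expansion hm u0_L2 l.+1 Y0.
exists C.
(* [t] is large enough for [s = t^(-1/2m)] to be in the range of the expansion. *)
have near_s : \forall t \near +oo, t `^ (- p) <= (16 * (N.+1)%:R)^-1.
  by apply: near_pinfty_powRN => //; rewrite invr_gt0 mulr_gt0.
near=> t => x Kx.
have t0 : 0 < t by near: t; exact: nbhs_pinfty_gt.
have ts : t `^ (- p) <= (16 * (N.+1)%:R)^-1 by near: t; exact: near_s.
set s := t `^ (- p) in ts *; have s0 : 0 < s by rewrite powR_gt0.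
have sN : 16 * s * N%:R <= 1.
  move: ts; rewrite -[_^-1]mul1r ler_pdivlMr ?mulr_gt0// => h; apply: le_trans h.
  rewrite -subr_ge0 -natr1 (_ : _ - _ = 16 * s); last by ring.
  by rewrite mulr_ge0// ltW.
pose J := complex_integral (fun z => kernelF m (s *: x - s *: z) * u0 z).
have HJ : Normc.normc (J - ((s ^+ l)%:C)%C * phi (s *: x)) <= C * s ^+ l.+1.
  rewrite /phi -signed_term.
  rewrite -(big_ord_last (F := fun k => (((- s) ^+ k / (k`!)%:R)%:C)%C *
      moment_term m u0 k (s *: x))); first exact: HC (ltW s0) sN (KY _ Kx).
  by move=> k kl; exact: (etrans (congr1 _ (lower k _ kl)) (mulr0 _)).
have tE : t `^ ((N + l)%:R / (2 * m)%:R) * t `^ (- (N%:R / (2 * m)%:R)) =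
    (s ^+ l)^-1.
  rewrite -powRD; last by rewrite (gt_eqF t0) implybT.
  rewrite /s -powR_mulrn ?powR_ge0// -powRrM -powRN; congr (_ `^ _).
  by rewrite natrD /p mulrDl addrAC subrr add0r mulNr opprK div1r mulrC.
rewrite /sol solutionE mulrA -rmorphM tE.
exact: normc_rescale s0 HJ.
Unshelve. all: by end_near. Qed.
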